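(* For every order function $h$ there is a function $f\in\mathrm{DNC}_h$ that computes no Kurtz random real.
   Context: An order function is a computable, nondecreasing, unbounded function $\omega\to\omega$. Let $(\varphi_e)$ be a standard enumeration of the partial computable functions. A function $f:\omega\to\omega$ is DNC if $f(e)\neq\varphi_e(e)$ whenever $\varphi_e(e)$ converges; $\mathrm{DNC}_h$ is the set of DNC functions $f$ with $f(e)<h(e)$ for all $e$. A real $Y\in 2^\omega$ is Kurtz random (weakly random) if it is not contained in any $\Pi^0_1$ class of Lebesgue measure $0$.
   Formalization: The formal theorem additionally assumes that DNC_h is nonempty (automatic when h ≥ 2); with the literal definition of order function, h(n)=n has h(0)=0, so DNC_h is empty and the claim fails. *)

(* Defs.v *)
From mathcomp Require Import all_boot all_order all_algebra.
From mathcomp Require Import all_classical all_reals all_analysis.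
From Stdlib Require Cantor.

Set Implicit Arguments.
Unset Strict Implicit.
Unset Printing Implicit Defensive.

Import Order.TTheory GRing.Theory Num.Theory.
Local Open Scope classical_set_scope.
Local Open Scope nat_scope.

(* Cantor.to_nat : nat * nat -> nat is a bijection with inverse
   Cantor.of_nat, so functions of several arguments are represented as
   functions of one argument. *)
Definition npair (x y : nat) : nat := Cantor.to_nat (x, y).
Definition nfst (p : nat) : nat := (Cantor.of_nat p).1.
Definition nsnd (p : nat) : nat := (Cantor.of_nat p).2.

(* Kleene's partial recursive functions with an oracle: [code] is the syntax
   of the functionals and [eval g c x y] means "with oracle g, the program c
   converges on input x, with output y". *)
Inductive code : Type :=
  | Zero | Succ | Fst | Snd | Oracle
  | Pair of code & code
  | Comp of code & code
  | Prec of code & code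
  | Mu of code.

(* If F, G are (graphs of) partial functions, this is the graph of the
   function defined by primitive recursion: r(x, 0) = F(x) and
   r(x, m + 1) = G(x, (m, r(x, m))). *)
Fixpoint prec_graph (F G : nat -> nat -> Prop) (x n y : nat) : Prop :=
  if n is m.+1 then
    exists2 z, prec_graph F G x m z & G (npair x (npair m z)) y
  else F x y.

Fixpoint eval (g : nat -> nat) (c : code) : nat -> nat -> Prop :=
  match c with
  | Zero => fun x y => y = 0
  | Succ => fun x y => y = x.+1
  | Fst => fun x y => y = nfst x
  | Snd => fun x y => y = nsnd x
  | Oracle => fun x y => y = g x
  | Pair c d => fun x y =>
      exists y1 y2, [/\ eval g c x y1, eval g d x y2 & y = npair y1 y2]
  | Comp c d => fun x y => exists2 z, eval g d x z & eval g c z y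
  | Prec c d => fun x y =>
      prec_graph (eval g c) (eval g d) (nfst x) (nsnd x) y
  | Mu c => fun x y =>
      eval g c (npair x y) 0 /\
      (forall z, z < y -> exists v, eval g c (npair x z) v.+1)
  end.

(* Partial functions are given by their graphs.  Without an oracle means with
   the zero oracle. *)
Definition partial_computable_in (g : nat -> nat) (psi : nat -> nat -> Prop) :=
  exists c : code, forall x y, psi x y <-> eval g c x y.

Definition partial_computable := partial_computable_in (fun=> 0).

Definition computable_in (g f : nat -> nat) :=
  partial_computable_in g (fun x y => y = f x).

Definition computable (f : nat -> nat) := computable_in (fun=> 0) f.

Definition order_function (h : nat -> nat) :=
  [/\ computable h,
      (forall m n, m <= n -> h m <= h n) &
      (forall k, exists n, k < h n)].

(* [phi e x y] stands for "phi_e(x) converges to y".  A standard enumeration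
   of the partial computable functions is an acceptable numbering in the sense
   of Rogers: it has a computable universal function and the s-m-n property.
   In particular every partial computable function is some phi_e. *)
Definition standard_enumeration (phi : nat -> nat -> nat -> Prop) :=
  partial_computable (fun p y => phi (nfst p) (nsnd p) y) /\
  (forall psi, partial_computable psi ->
     exists s : nat -> nat, computable s /\
       forall i x y, phi (s i) x y <-> psi (npair i x) y).

Definition DNC (phi : nat -> nat -> nat -> Prop) (f : nat -> nat) :=
  forall e y, phi e e y -> f e <> y.

(* DNC_h; it is empty in degenerate cases such as h 0 = 0, which the definition
   of order functions allows, and it is nonempty as soon as h e >= 2 for all
   e. *)
Definition DNC_bounded (phi : nat -> nat -> nat -> Prop) (h f : nat -> nat) :=
  DNC phi f /\ (forall e, f e < h e).

Definition real := nat -> bool.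

Definition computes (f : nat -> nat) (Y : real) :=
  computable_in f (fun n => nat_of_bool (Y n)).

Definition cylinder (s : seq bool) : set real :=
  [set X | mkseq X (size s) = s].

(* The string s is coded by the number whose binary expansion is 1s. *)
Definition string_code (s : seq bool) : nat :=
  foldl (fun n (b : bool) => n.*2 + b) 1 s.

Definition ce_strings (W : set (seq bool)) :=
  exists psi, partial_computable psi /\
    forall s, W s <-> exists y, psi (string_code s) y.

Definition Sigma01 (U : set real) :=
  exists W, ce_strings W /\ U = \bigcup_(s in W) cylinder s.

Definition Pi01 (P : set real) := Sigma01 (~` P).

(* Lebesgue (uniform) measure on Cantor space, as the outer measure generated
   by giving the cylinder of s the measure 2 ^ - |s|; on the Borel sets, and
   in particular on the Pi01 classes, this is the Lebesgue measure. *)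
Definition cantor_measure (R : realType) (A : set real) : \bar R :=
  ereal_inf
    [set (\sum_(0 <= i <oo) ((2%:R^-1 : R) ^+ size (s i))%R%:E)%E |
      s in [set s : nat -> seq bool | A `<=` \bigcup_i cylinder (s i)]].

Definition kurtz_random (R : realType) (Y : real) :=
  forall P : set real, Pi01 P -> cantor_measure R P = 0%E -> ~ P Y.

(* Main.v *)
Require Import Defs.
From mathcomp Require Import all_boot all_order all_algebra.
From mathcomp Require Import all_classical all_reals all_analysis.
From mathcomp Require Import ring lra zify.
From Stdlib Require Cantor.
(* [all_analysis] shadows [code] and [eval]. *)
Import Defs.

(* Forcing with bushy trees. A condition consists of a string s, a c.e. tree T
   containing s, and a c.e. set B of bad strings, where T branches 2 ^ q times
   at every string outside B while B is 2 ^ p-small above s in T (no finite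
   subtree with 2 ^ p-fold branching has all its leaves in B), and q - p tends
   to infinity. Initially T is the set of h-bounded strings and B the set of
   non-DNC strings, which is 2-small.

   To defeat a functional c, pick p' halfway between p and q. If for some n and
   some t in T the set of strings in B or making c converge at n is 2 ^ p'-small
   above t, move to t and add this set to B: c becomes partial. Otherwise
   convergence at any j is 2 ^ p'-big above every string of T. For i < j let
   S i j be the event "not (c(i) = 1 and c(j) = 0)". Convergence at j gives S i j
   or S j k for all i < j < k, so above each string one of the two is
   2 ^ (p' - 1)-big; since the shift graph has infinite chromatic number, some
   single pair i < j works for any given finite set of strings at once.
   Iterating, one obtains computably bits i_0 < j_0 < i_1 < j_1 < ... and a
   2 ^ (p' - 1)-branching subtree of T all of whose paths f avoiding B satisfy
   all the S i_n j_n. These events are independent of measure 3/4, so the reals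
   satisfying all of them form a null Pi01 class. *)

Set Implicit Arguments.
Unset Strict Implicit.
Unset Printing Implicit Defensive.

(** * Recursive functions on coded types *)

Lemma nfst_pair x y : nfst (npair x y) = x.
Proof. by rewrite /nfst /npair Cantor.cancel_of_to. Qed.

Lemma nsnd_pair x y : nsnd (npair x y) = y.
Proof. by rewrite /nsnd /npair Cantor.cancel_of_to. Qed.

Lemma npairK p : npair (nfst p) (nsnd p) = p.
Proof.
by rewrite /nfst /nsnd /npair -[RHS]Cantor.cancel_to_of -surjective_pairing.
Qed.

Lemma nsnd_le p : nsnd p <= p.
Proof.
rewrite -{2}(npairK p) /npair.
have /leP := Cantor.to_nat_non_decreasing (nfst p) (nsnd p).
by apply: leq_trans; rewrite plusE leq_addr.
Qed.

Lemma computable_ext f g : f =1 g -> computable f -> computable g.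
Proof. by move=> fg [c cP]; exists c => x y; rewrite -fg. Qed.

Lemma computable_comp g f :
  computable g -> computable f -> computable (fun x => g (f x)).
Proof.
move=> [c cP] [d dP]; exists (Comp c d) => x y /=; split.
  by move=> ->; exists (f x); [apply/dP|apply/cP].
by move=> [z /dP -> /cP].
Qed.

Lemma computable_pair f g :
  computable f -> computable g -> computable (fun x => npair (f x) (g x)).
Proof.
move=> [c cP] [d dP]; exists (Pair c d) => x y /=; split.
  by move=> ->; exists (f x), (g x); split; [apply/cP|apply/dP|].
by move=> [y1 [y2 [/cP -> /dP -> ->]]].
Qed.

Lemma computable_id : computable id.
Proof.
exists (Pair Fst Snd) => x y /=; split; last first.
  by move=> [y1 [y2 [-> -> ->]]]; rewrite npairK.
by move=> ->; exists (nfst x), (nsnd x); rewrite npairK.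
Qed.

Lemma computable_cst n : computable (fun=> n).
Proof.
elim: n => [|n IH]; first by exists Zero.
by apply: (computable_comp (g := succn)) IH; exists Succ.
Qed.

Lemma computable_iteri F G : computable F -> computable G ->
  computable (fun p => iteri (nsnd p)
    (fun m r => G (npair (nfst p) (npair m r))) (F (nfst p))).
Proof.
move=> [c cP] [d dP]; exists (Prec c d) => x y /=.
elim: (nsnd x) y => [|n IH] y /=; first exact: cP.
split=> [->|[z /IH -> /dP //]].
by eexists; [apply/IH; reflexivity|apply/dP].
Qed.

(** * Codings of types by natural numbers *)

Class coding (T : Type) := Coding {
  enc : T -> nat; dec : nat -> T; encK : cancel enc dec; decK : cancel dec enc }.

#[global] Instance coding_nat : coding nat :=
  {| enc := id; dec := id; encK := frefl _; decK := frefl _ |}.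

Definition enc_prod T U (cT : coding T) (cU : coding U) (z : T * U) : nat :=
  npair (enc z.1) (enc z.2).

Definition dec_prod T U (cT : coding T) (cU : coding U) (n : nat) : T * U :=
  (dec (nfst n), dec (nsnd n)).

Lemma enc_prodK T U (cT : coding T) (cU : coding U) :
  cancel (enc_prod cT cU) (dec_prod cT cU).
Proof. by move=> [x y]; rewrite /dec_prod nfst_pair nsnd_pair !encK. Qed.

Lemma dec_prodK T U (cT : coding T) (cU : coding U) :
  cancel (dec_prod cT cU) (enc_prod cT cU).
Proof. by move=> n; rewrite /enc_prod !decK npairK. Qed.

#[global] Instance coding_prod T U (cT : coding T) (cU : coding U) :
  coding (T * U) := Coding (enc_prodK cT cU) (dec_prodK cT cU).

Fixpoint enc_seq T (cT : coding T) (s : seq T) : nat :=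
  if s is x :: s' then (npair (enc x) (enc_seq cT s')).+1 else 0.

(** [k] is fuel that makes the recursion structural; since [nsnd m <= m], fuel [n] suffices to
    decode [n]. *)
Fixpoint dec_seq T (cT : coding T) k n : seq T :=
  if (k, n) is (k'.+1, m.+1) then dec (nfst m) :: dec_seq cT k' (nsnd m)
  else [::].

Lemma dec_seqK T (cT : coding T) k n : n <= k -> enc_seq cT
    (dec_seq cT k n) = n.
Proof.
elim: k n => [|k IH] [|n] //= nk.
by rewrite decK IH ?npairK // (leq_trans (nsnd_le n)).
Qed.

Lemma enc_seq_inj T (cT : coding T) : injective (enc_seq cT).
Proof.
elim=> [|x s IH] [|y t] //= [exy].
have := congr1 nfst exy; have := congr1 nsnd exy.
rewrite !nfst_pair !nsnd_pair => /IH st /(can_inj (@encK _ cT)) xy.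
by rewrite st xy.
Qed.

Lemma enc_seqK T (cT : coding T) :
  cancel (enc_seq cT) (fun n => dec_seq cT n n).
Proof. by move=> s; apply/(@enc_seq_inj _ cT); rewrite dec_seqK. Qed.

Lemma dec_seq_diagK T (cT : coding T) :
  cancel (fun n => dec_seq cT n n) (enc_seq cT).
Proof. by move=> n; rewrite dec_seqK. Qed.

#[global] Instance coding_seq T (cT : coding T) : coding (seq T) :=
  Coding (enc_seqK cT) (dec_seq_diagK cT).

(** Codings being bijections, [enc] and [dec] are both tracked by the identity, so searches may run
    over codes. *)
Definition recursive T U {cT : coding T} {cU : coding U} (f : T -> U) :=
  exists2 g, computable g & forall x, enc (f x) = g (enc x).

(** * Closure properties of recursive functions *)

Lemma recursive_ext T U {cT : coding T} {cU : coding U} (f g : T -> U) :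
  f =1 g -> recursive f -> recursive g.
Proof. by move=> fg [u cu uP]; exists u => // x; rewrite -fg. Qed.

Lemma recursive_id T {cT : coding T} : recursive (fun x : T => x).
Proof. by exists id => //; exact: computable_id. Qed.

Lemma recursive_cst T U {cT : coding T} {cU : coding U} (u : U) :
  recursive (fun _ : T => u).
Proof. by exists (fun=> enc u) => //; exact: computable_cst. Qed.

Lemma recursive_comp T U V {cT : coding T} {cU : coding U} {cV : coding V}
  (g : U -> V) (f : T -> U) :
  recursive g -> recursive f -> recursive (fun x => g (f x)).
Proof.
move=> [u cu uP] [v cv vP]; exists (fun x => u (v x)); first exact: computable_comp.
by move=> x; rewrite uP vP.
Qed.

Lemma recursive_pair T U V {cT : coding T} {cU : coding U} {cV : coding V}
  (f : T -> U) (g : T -> V) :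
  recursive f -> recursive g -> recursive (fun x => (f x, g x)).
Proof.
move=> [u cu uP] [v cv vP]; exists (fun x => npair (u x) (v x)).
  exact: computable_pair.
by move=> x /=; rewrite /enc_prod uP vP.
Qed.

Lemma recursive_fst T U V {cT : coding T} {cU : coding U} {cV : coding V}
  (f : T -> U * V) : recursive f -> recursive (fun x => (f x).1).
Proof.
apply: (recursive_comp (g := fst)); exists nfst; first by exists Fst.
by move=> x /=; rewrite /enc_prod nfst_pair.
Qed.

Lemma recursive_snd T U V {cT : coding T} {cU : coding U} {cV : coding V}
  (f : T -> U * V) : recursive f -> recursive (fun x => (f x).2).
Proof.
apply: (recursive_comp (g := snd)); exists nsnd; first by exists Snd.
by move=> x /=; rewrite /enc_prod nsnd_pair.
Qed.

Lemma recursive_comp2 T U V W {cT : coding T} {cU : coding U} {cV : coding V}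
    {cW : coding W} (op : U -> V -> W) (f : T -> U) (g : T -> V) :
  recursive (fun z : U * V => op z.1 z.2) -> recursive f -> recursive g ->
  recursive (fun x => op (f x) (g x)).
Proof.
move=> rop rf rg.
exact: (recursive_comp (g := fun z => op z.1 z.2) rop (recursive_pair rf rg)).
Qed.

Lemma recursive_enc T {cT : coding T} : recursive (enc : T -> nat).
Proof. by exists id => //; exact: computable_id. Qed.

Lemma recursive_dec T {cT : coding T} : recursive (dec : nat -> T).
Proof. by exists id; [exact: computable_id|move=> n; rewrite decK]. Qed.

Lemma recursive_succ T {cT : coding T} (f : T -> nat) :
  recursive f -> recursive (fun x => (f x).+1).
Proof. by apply: (recursive_comp (g := succn)); exists succn => //; exists Succ. Qed.

Lemma recursive_iteri T U {cT : coding T} {cU : coding U} (N : T -> nat)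
    (G : T -> nat -> U -> U) (F : T -> U) :
  recursive N -> recursive (fun z : T * (nat * U) => G z.1 z.2.1 z.2.2) ->
  recursive F -> recursive (fun x => iteri (N x) (G x) (F x)).
Proof.
move=> rN [g cg gP] [f cf fP].
apply: (recursive_comp2 (op := fun x n => iteri n (G x) (F x)));
  [|exact: recursive_id|exact: rN].
eexists; first exact: (computable_iteri cf cg).
move=> [x n] /=; rewrite /enc_prod nfst_pair nsnd_pair.
by elim: n => [|n IH] //=; rewrite -IH -(gP (x, (n, _))).
Qed.

(** A case distinction is an iteration that forgets its accumulator: only the last round counts, and
    its index is the predecessor of [N x]. *)
Lemma recursive_case T U {cT : coding T} {cU : coding U} (N : T -> nat)
    (G : T -> nat -> U) (F : T -> U) :
  recursive N -> recursive (fun z : T * nat => G z.1 z.2) -> recursive F ->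
  recursive (fun x => if N x is m.+1 then G x m else F x).
Proof.
move=> rN rG rF.
apply: (recursive_ext (f := fun x => iteri (N x) (fun m _ => G x m) (F x))).
  by move=> x; case: (N x).
apply: recursive_iteri => //.
apply: (recursive_comp (g := fun z : T * nat => G z.1 z.2)
  (f := fun z : T * (nat * U) => (z.1, z.2.1))) => //.
by apply: recursive_pair; do ?[apply: recursive_fst|apply: recursive_snd];
  exact: recursive_id.
Qed.

Lemma size_enc_le T (cT : coding T) (s : seq T) : size s <= enc s.
Proof.
elim: s => //= x s IH; rewrite ltnS (leq_trans IH) //.
by have := nsnd_le (npair (@enc T cT x) (enc_seq cT s)); rewrite nsnd_pair.
Qed.

(** One round of a loop on the remaining list and the accumulator. The list is inspected through its
    code, whose predecessor codes head and tail, so that [recursive_case] applies; on the empty list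
    the loop idles. *)
Definition foldl_step T U V (cV : coding V) (G : T -> U -> V -> U) (x : T)
    (z : seq V * U) : seq V * U :=
  if enc z.1 is m.+1 then
    let vs := dec m : V * seq V in (vs.2, G x z.2 vs.1) else z.

Lemma foldl_step_cons T U V (cV : coding V) (G : T -> U -> V -> U) x v s u :
  foldl_step cV G x (v :: s, u) = (s, G x u v).
Proof.
rewrite /foldl_step; case E: (enc _) => [|m] //.
have -> : m = enc (v, s) by case: E.
by rewrite encK.
Qed.

(** Iterates [foldl_step]; the code of the list serves as number of rounds, being at least the
    length by [size_enc_le]. *)
Lemma recursive_foldl T U V {cT : coding T} {cU : coding U} {cV : coding V}
    (L : T -> seq V) (G : T -> U -> V -> U) (F : T -> U) :
  recursive L -> recursive (fun z : T * (U * V) => G z.1 z.2.1 z.2.2) ->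
  recursive F -> recursive (fun x => foldl (G x) (F x) (L x)).
Proof.
move=> rL rG rF.
pose step := foldl_step cV G.
apply: (recursive_ext
  (f := fun x => (iteri (enc (L x)) (fun _ => step x) (L x, F x)).2)) => [x|].
  suff H n s u : size s <= n ->
      iteri n (fun _ => step x) (s, u) = ([::], foldl (G x) u s).
    by rewrite H // size_enc_le.
  have iterS m (z : seq V * U) :
      iteri m.+1 (fun _ => step x) z = iteri m (fun _ => step x) (step x z).
    by elim: m => //= m ->.
  elim: n s u => [|n IH] [|v s] u //; rewrite iterS; first by rewrite IH.
  by rewrite ltnS /step foldl_step_cons => /IH ->.
apply: recursive_snd; apply: recursive_iteri.
- exact: (recursive_comp (@recursive_enc _ _)).
- rewrite /step /foldl_step; set W := (T * (nat * (seq V * U)))%type.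
  have r1 : recursive (fun z : W => z.1) by apply: recursive_fst; exact: recursive_id.
  have r2 : recursive (fun z : W => z.2.2).
    by do 2!apply: recursive_snd; exact: recursive_id.
  apply: recursive_case => //.
    apply: (recursive_comp (@recursive_enc _ _)); exact: recursive_fst.
  have rd : recursive (fun z : W * nat => dec z.2 : V * seq V).
    apply: (recursive_comp (@recursive_dec _ _)).
    by apply: recursive_snd; exact: recursive_id.
  apply: recursive_pair; first exact: recursive_snd.
  apply: (recursive_comp (g := fun z : T * (U * V) => G z.1 z.2.1 z.2.2)
    (f := fun w : W * nat => (w.1.1, (w.1.2.2.2, (dec w.2 : V * seq V).1)))) => //.
  apply: recursive_pair; last apply: recursive_pair.
  + by do 2!apply: recursive_fst; exact: recursive_id.
  + by do 3!apply: recursive_snd; apply: recursive_fst; exact: recursive_id.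
  + exact: recursive_fst.
- exact: recursive_pair.
Qed.

(** * Recursive predicates, arithmetic and list operations *)

Definition recursive_pred T {cT : coding T} (A : T -> bool) :=
  recursive (fun x => nat_of_bool (A x)).

Lemma recursive_if T U {cT : coding T} {cU : coding U} (A : T -> bool)
    (f g : T -> U) :
  recursive_pred A -> recursive f -> recursive g ->
  recursive (fun x => if A x then f x else g x).
Proof.
move=> rA rf rg.
apply: (recursive_ext
  (f := fun x => if nat_of_bool (A x) is m.+1 then f x else g x)).
  by move=> x; case: (A x).
apply: recursive_case => //; apply: recursive_comp rf _.
exact/recursive_fst/recursive_id.
Qed.

Lemma recursive_pred_if T {cT : coding T} (A B C : T -> bool) :
  recursive_pred A -> recursive_pred B -> recursive_pred C ->
  recursive_pred (fun x => if A x then B x else C x).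
Proof.
move=> rA rB rC; apply: (recursive_ext _ (recursive_if rA rB rC)) => x.
by case: (A x).
Qed.

Lemma recursive_pred_ext T {cT : coding T} (A B : T -> bool) :
  A =1 B -> recursive_pred A -> recursive_pred B.
Proof. by move=> AB; apply: recursive_ext => x; rewrite AB. Qed.

Lemma recursive_pred_comp T U {cT : coding T} {cU : coding U} (A : U -> bool)
    (f : T -> U) :
  recursive_pred A -> recursive f -> recursive_pred (fun x => A (f x)).
Proof. exact: recursive_comp. Qed.

Lemma recursive_pred_cst T {cT : coding T} b : recursive_pred (fun _ : T => b).
Proof. exact: recursive_cst. Qed.

Lemma recursive_negb T {cT : coding T} (A : T -> bool) :
  recursive_pred A -> recursive_pred (fun x => ~~ A x).
Proof.
move=> rA; apply: (recursive_pred_ext (A := fun x => if A x then false else true)).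
  by move=> x; case: (A x).
by apply: recursive_pred_if => //; exact: recursive_pred_cst.
Qed.

Lemma recursive_andb T {cT : coding T} (A B : T -> bool) :
  recursive_pred A -> recursive_pred B -> recursive_pred (fun x => A x && B x).
Proof. by move=> rA rB; apply: recursive_pred_if => //; exact: recursive_pred_cst. Qed.

Lemma recursive_orb T {cT : coding T} (A B : T -> bool) :
  recursive_pred A -> recursive_pred B -> recursive_pred (fun x => A x || B x).
Proof. by move=> rA rB; apply: recursive_pred_if => //; exact: recursive_pred_cst. Qed.

Lemma recursive_predn T {cT : coding T} (f : T -> nat) :
  recursive f -> recursive (fun x => (f x).-1).
Proof.
move=> rf; apply: (recursive_ext (f := fun x => if f x is m.+1 then m else 0)).
  by move=> x; case: (f x).
apply: recursive_case => //; last exact: recursive_cst.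
exact/recursive_snd/recursive_id.
Qed.

Lemma recursive_addn T {cT : coding T} (f g : T -> nat) :
  recursive f -> recursive g -> recursive (fun x => f x + g x).
Proof.
move=> rf rg.
apply: (recursive_ext (f := fun x => iteri (g x) (fun _ r => r.+1) (f x))).
  by move=> x; elim: (g x) => [|n /= ->]; rewrite ?addn0 ?addnS.
apply: recursive_iteri => //; apply: recursive_succ.
exact/recursive_snd/recursive_snd/recursive_id.
Qed.

Lemma recursive_subn T {cT : coding T} (f g : T -> nat) :
  recursive f -> recursive g -> recursive (fun x => f x - g x).
Proof.
move=> rf rg.
apply: (recursive_ext (f := fun x => iteri (g x) (fun _ r => r.-1) (f x))).
  by move=> x; elim: (g x) => [|n /= ->]; rewrite ?subn0 ?subnS.
apply: recursive_iteri => //; apply: recursive_predn.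
exact/recursive_snd/recursive_snd/recursive_id.
Qed.

Lemma recursive_leq T {cT : coding T} (f g : T -> nat) :
  recursive f -> recursive g -> recursive_pred (fun x => f x <= g x).
Proof.
move=> rf rg.
apply: (recursive_ext (f := fun x => if f x - g x is m.+1 then 0 else 1)).
  by move=> x; rewrite /leq; case: (f x - g x).
apply: recursive_case; [exact: recursive_subn|exact: recursive_cst..].
Qed.

Lemma recursive_double T {cT : coding T} (f : T -> nat) :
  recursive f -> recursive (fun x => (f x).*2).
Proof.
move=> rf; apply: (recursive_ext (f := fun x => f x + f x)).
  by move=> x; rewrite addnn.
exact: recursive_addn.
Qed.

Lemma recursive_exp2 T {cT : coding T} (f : T -> nat) :
  recursive f -> recursive (fun x => 2 ^ f x).
Proof.
move=> rf.
apply: (recursive_ext (f := fun x => iteri (f x) (fun _ r => r + r) 1)).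
  by move=> x; elim: (f x) => [|n /= ->] //; rewrite expnS mul2n addnn.
apply: recursive_iteri; [by []| |exact: recursive_cst].
by apply: recursive_addn; exact/recursive_snd/recursive_snd/recursive_id.
Qed.

Lemma recursive_half T {cT : coding T} (f : T -> nat) :
  recursive f -> recursive (fun x => (f x)./2).
Proof.
move=> rf.
(* Halving satisfies [(m.+1)./2 = m - m./2]. *)
apply: (recursive_ext (f := fun x => iteri (f x) (fun m r => m - r) 0)).
  move=> x; elim: (f x) => [|n /= ->] //.
  by rewrite -{1}(odd_double_half n) -addnn uphalf_half addnA addnK.
apply: recursive_iteri; [by []| |exact: recursive_cst].
apply: recursive_subn; first exact/recursive_fst/recursive_snd/recursive_id.
exact/recursive_snd/recursive_snd/recursive_id.
Qed.

Lemma recursive_cons T U {cT : coding T} {cU : coding U} (f : T -> U)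
    (g : T -> seq U) :
  recursive f -> recursive g -> recursive (fun x => f x :: g x).
Proof.
apply: (recursive_comp2 (op := cons)); exists succn; first by exists Succ.
by case.
Qed.

Lemma recursive_behead T U {cT : coding T} {cU : coding U} (f : T -> seq U) :
  recursive f -> recursive (fun x => behead (f x)).
Proof.
apply: (recursive_comp (g := behead)); exists (fun n => nsnd n.-1); last first.
  by case=> [|x s] //=; rewrite nsnd_pair.
apply: (computable_comp (g := nsnd)); first by exists Snd.
have [g cg gP] := recursive_predn (@recursive_id nat _).
by apply: (computable_ext _ cg) => x; rewrite -gP.
Qed.

Lemma recursive_rev T U {cT : coding T} {cU : coding U} (f : T -> seq U) :
  recursive f -> recursive (fun x => rev (f x)).
Proof.
move=> rf; apply: (recursive_ext
  (f := fun x => foldl (fun s v => v :: s) [::] (f x))).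
  move=> x; rewrite -[rev _]cats0; move: [::] => t; elim: (f x) t => //= v s IH t.
  by rewrite IH rev_cons cat_rcons.
apply: recursive_foldl => //; last exact: recursive_cst.
apply: recursive_cons; first exact/recursive_snd/recursive_snd/recursive_id.
exact/recursive_fst/recursive_snd/recursive_id.
Qed.

Lemma recursive_size T U {cT : coding T} {cU : coding U} (f : T -> seq U) :
  recursive f -> recursive (fun x => size (f x)).
Proof.
move=> rf; apply: (recursive_ext (f := fun x => foldl (fun n _ => n.+1) 0 (f x))).
  move=> x; rewrite -[size _]addn0; move: 0 => n.
  by elim: (f x) n => //= v s IH n; rewrite IH addSnnS.
apply: recursive_foldl => //; last exact: recursive_cst.
exact/recursive_succ/recursive_fst/recursive_snd/recursive_id.
Qed.

Lemma recursive_drop T U {cT : coding T} {cU : coding U} (n : T -> nat)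
    (f : T -> seq U) :
  recursive n -> recursive f -> recursive (fun x => drop (n x) (f x)).
Proof.
move=> rn rf; apply: (recursive_ext
  (f := fun x => iteri (n x) (fun _ s => behead s) (f x))).
  by move=> x; elim: (n x) => [|k /= ->]; rewrite ?drop0 // -drop1 drop_drop.
apply: recursive_iteri => //; apply: recursive_behead.
exact/recursive_snd/recursive_snd/recursive_id.
Qed.

Lemma recursive_nth T U {cT : coding T} {cU : coding U} (u : U) (n : T -> nat)
    (f : T -> seq U) :
  recursive n -> recursive f -> recursive (fun x => nth u (f x) (n x)).
Proof.
move=> rn rf; apply: (recursive_ext
  (f := fun x => foldl (fun _ v => v) u (rev (drop (n x) (f x))))).
  move=> x; rewrite -[in RHS](addn0 (n x)) -nth_drop; move: (drop _ _) => s.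
  by case: s => //= v s; rewrite rev_cons -cats1 foldl_cat.
apply: recursive_foldl; [|by do 2!apply: recursive_snd; exact: recursive_id|].
  exact/recursive_rev/recursive_drop.
exact: recursive_cst.
Qed.

Lemma recursive_rcons T U {cT : coding T} {cU : coding U} (f : T -> seq U)
    (g : T -> U) :
  recursive f -> recursive g -> recursive (fun x => rcons (f x) (g x)).
Proof.
move=> rf rg; apply: (recursive_ext (f := fun x => rev (g x :: rev (f x)))).
  by move=> x; rewrite rev_cons revK.
exact/recursive_rev/recursive_cons/recursive_rev.
Qed.

Lemma recursive_cat T U {cT : coding T} {cU : coding U} (f g : T -> seq U) :
  recursive f -> recursive g -> recursive (fun x => f x ++ g x).
Proof.
move=> rf rg; apply: (recursive_ext
  (f := fun x => foldl (fun s v => rcons s v) (f x) (g x))).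
  by move=> x; elim: (g x) (f x) => [|v s IH] t /=; rewrite ?cats0 ?IH ?cat_rcons.
apply: recursive_foldl => //; apply: recursive_rcons.
  exact/recursive_fst/recursive_snd/recursive_id.
exact/recursive_snd/recursive_snd/recursive_id.
Qed.

Lemma recursive_iota T {cT : coding T} (f g : T -> nat) :
  recursive f -> recursive g -> recursive (fun x => iota (f x) (g x)).
Proof.
move=> rf rg; apply: (recursive_ext
  (f := fun x => iteri (g x) (fun k s => rcons s (f x + k)) [::])).
  move=> x; elim: (g x) => [|n /= ->] //.
  by rewrite -[RHS]/(iota (f x) n.+1) -[in RHS]addn1 iotaD cats1.
apply: recursive_iteri => //; last exact: recursive_cst.
apply: recursive_rcons; first exact/recursive_snd/recursive_snd/recursive_id.
apply: recursive_addn; last exact/recursive_fst/recursive_snd/recursive_id.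
apply: recursive_comp rf _; exact/recursive_fst/recursive_id.
Qed.

Lemma recursive_all T U {cT : coding T} {cU : coding U} (A : T -> U -> bool)
    (f : T -> seq U) :
  recursive_pred (fun z : T * U => A z.1 z.2) -> recursive f ->
  recursive_pred (fun x => all (A x) (f x)).
Proof.
move=> rA rf; apply: (recursive_ext
  (f := fun x => foldl (fun n v => nat_of_bool ((0 < n) && A x v)) 1 (f x))).
  move=> x; rewrite -[all _ _]andTb -[X in foldl _ X]/(nat_of_bool true).
  elim: (f x) true => [|v s IH] b /=; first by rewrite andbT.
  by rewrite lt0b IH andbA.
apply: recursive_foldl => //; last exact: recursive_cst.
apply: recursive_andb.
  apply: recursive_leq; first exact: recursive_cst.
  exact/recursive_fst/recursive_snd/recursive_id.
apply: (recursive_pred_comp (A := fun z : T * U => A z.1 z.2)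
  (f := fun z : T * (nat * U) => (z.1, z.2.2))) => //.
apply: recursive_pair; first exact/recursive_fst/recursive_id.
exact/recursive_snd/recursive_snd/recursive_id.
Qed.

Lemma recursive_eq T {cT : coding T} (U : eqType) {cU : coding U}
    (f g : T -> U) :
  recursive f -> recursive g -> recursive_pred (fun x => f x == g x).
Proof.
move=> rf rg; apply: (recursive_pred_ext
  (A := fun x => (enc (f x) <= enc (g x)) && (enc (g x) <= enc (f x)))).
  by move=> x; rewrite -eqn_leq (can_eq (@encK U cU)).
by apply: recursive_andb; apply: recursive_leq;
  apply: (recursive_comp (@recursive_enc _ _)).
Qed.

Lemma recursive_has T U {cT : coding T} {cU : coding U} (A : T -> U -> bool)
    (f : T -> seq U) :
  recursive_pred (fun z : T * U => A z.1 z.2) -> recursive f ->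
  recursive_pred (fun x => has (A x) (f x)).
Proof.
move=> rA rf; apply: (recursive_pred_ext
  (A := fun x => ~~ all (fun v => ~~ A x v) (f x))).
  by move=> x; rewrite -has_predC; apply: eq_has => v /=; rewrite negbK.
by apply: recursive_negb; apply: recursive_all => //; exact: recursive_negb.
Qed.

Lemma recursive_mem T {cT : coding T} (U : eqType) {cU : coding U} (f : T -> U)
    (g : T -> seq U) :
  recursive f -> recursive g -> recursive_pred (fun x => f x \in g x).
Proof.
move=> rf rg; apply: (recursive_pred_ext (A := fun x => has (fun v => v == f x) (g x))).
  by move=> x; rewrite has_pred1.
apply: recursive_has => //; apply: recursive_eq; first exact/recursive_snd/recursive_id.
apply: recursive_comp rf _; exact/recursive_fst/recursive_id.
Qed.

Lemma recursive_prefix T {cT : coding T} (U : eqType) {cU : coding U}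
    (f g : T -> seq U) :
  recursive f -> recursive g -> recursive_pred (fun x => prefix (f x) (g x)).
Proof.
move=> rf rg; apply: (recursive_pred_ext
  (A := fun x => f x ++ drop (size (f x)) (g x) == g x)).
  move=> x; apply/eqP/prefixP => [<-|[s ->]]; last by rewrite drop_size_cat.
  by exists (drop (size (f x)) (g x)).
apply: recursive_eq => //; apply: recursive_cat => //; apply: recursive_drop => //.
exact: recursive_size.
Qed.

Lemma recursive_uniq T {cT : coding T} (f : T -> seq nat) :
  recursive f -> recursive_pred (fun x => uniq (f x)).
Proof.
move=> rf; apply: (recursive_pred_ext
  (A := fun x => all (fun i => nth 0 (f x) i \notin drop i.+1 (f x))
    (iota 0 (size (f x))))).
  move=> x; elim: (f x) => //= n s IH; rewrite drop0 -IH; congr andb.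
  by rewrite (iotaDl 1 0) all_map.
apply: recursive_all; last exact/recursive_iota/recursive_size/rf/recursive_cst.
have rf1 : recursive (fun z : T * nat => f z.1).
  by apply: recursive_comp rf _; exact/recursive_fst/recursive_id.
have r2 : recursive (fun z : T * nat => z.2) by exact/recursive_snd/recursive_id.
apply: recursive_negb; apply: recursive_mem; first exact: recursive_nth.
by apply: recursive_drop => //; exact: recursive_succ.
Qed.

Lemma recursive_nfst T {cT : coding T} (f : T -> nat) :
  recursive f -> recursive (fun x => nfst (f x)).
Proof. by apply: (recursive_comp (g := nfst)); exists nfst => //; exists Fst. Qed.

Lemma recursive_nsnd T {cT : coding T} (f : T -> nat) :
  recursive f -> recursive (fun x => nsnd (f x)).
Proof. by apply: (recursive_comp (g := nsnd)); exists nsnd => //; exists Snd. Qed.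

Lemma recursive_npair T {cT : coding T} (f g : T -> nat) :
  recursive f -> recursive g -> recursive (fun x => npair (f x) (g x)).
Proof.
by apply: (recursive_comp2 (op := npair)); exists id => //; exact: computable_id.
Qed.

(** Recursiveness is derived along the outermost symbol of the term; hypotheses on parameter
    functions enter by composition. *)
Ltac recursion := repeat lazymatch goal with
  | |- recursive (fun z => z) => exact: recursive_id
  | |- recursive size => exact: (recursive_size (@recursive_id _ _))
  | |- recursive fst => exact: (recursive_fst (@recursive_id _ _))
  | |- recursive snd => exact: (recursive_snd (@recursive_id _ _))
  | |- recursive (fun z => (@?f z).1) => apply (@recursive_fst _ _ _ _ _ _ f)
  | |- recursive (fun z => (@?f z).2) => apply (@recursive_snd _ _ _ _ _ _ f)
  | |- recursive (fun z => (@?f z, @?g z)) => apply: (@recursive_pair _ _ _ _ _ _ f g)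
  | |- recursive (fun _ => ?u) => exact: recursive_cst
  | |- recursive (fun z => (@?f z).+1) => apply: (@recursive_succ _ _ f)
  | |- recursive (fun z => (@?f z).-1) => apply: (@recursive_predn _ _ f)
  | |- recursive (fun z => addn (@?f z) (@?g z)) => apply: (@recursive_addn _ _ f g)
  | |- recursive (fun z => subn (@?f z) (@?g z)) => apply: (@recursive_subn _ _ f g)
  | |- recursive (fun z => double (@?f z)) => apply: (@recursive_double _ _ f)
  | |- recursive (fun z => half (@?f z)) => apply: (@recursive_half _ _ f)
  | |- recursive (fun z => expn 2 (@?f z)) => apply: (@recursive_exp2 _ _ f)
  | |- recursive (fun z => nfst (@?f z)) => apply: (@recursive_nfst _ _ f)
  | |- recursive (fun z => nsnd (@?f z)) => apply: (@recursive_nsnd _ _ f)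
  | |- recursive (fun z => npair (@?f z) (@?g z)) => apply: (@recursive_npair _ _ f g)
  | |- recursive (fun z => @?f z :: @?g z) => apply: (@recursive_cons _ _ _ _ f g)
  | |- recursive (fun z => size (@?f z)) => apply: (@recursive_size _ _ _ _ f)
  | |- recursive (fun z => rcons (@?f z) (@?g z)) => apply: (@recursive_rcons _ _ _ _ f g)
  | |- recursive (fun z => @?f z ++ @?g z) => apply: (@recursive_cat _ _ _ _ f g)
  | |- recursive (fun z => nth ?u (@?f z) (@?n z)) => apply: (@recursive_nth _ _ _ _ u n f)
  | |- recursive (fun z => iota (@?f z) (@?n z)) => apply: (@recursive_iota _ _ f n)
  | |- recursive (fun z => if _ then _ else _) => apply: recursive_if
  | |- recursive_pred (fun z => @?A z && @?B z) => apply: (@recursive_andb _ _ A B)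
  | |- recursive_pred (fun z => @?A z || @?B z) => apply: (@recursive_orb _ _ A B)
  | |- recursive_pred (fun z => ~~ @?A z) => apply: (@recursive_negb _ _ A)
  | |- recursive_pred (fun z => leq (@?f z) (@?g z)) => apply: (@recursive_leq _ _ f g)
  | |- recursive_pred (fun z => @?f z == @?g z) => apply: (@recursive_eq _ _ _ _ f g)
  | |- recursive_pred (fun z => prefix (@?f z) (@?g z)) =>
      apply: (@recursive_prefix _ _ _ _ f g)
  | |- recursive_pred (fun z => uniq (@?f z)) => apply: (@recursive_uniq _ _ f)
  | |- recursive_pred (fun z => @?f z \in @?g z) => apply: (@recursive_mem _ _ _ _ f g)
  | H : recursive ?p |- recursive (fun z => ?p (@?f z)) => apply: (recursive_comp H (f := f))
  | H : recursive_pred ?p |- recursive_pred (fun z => ?p (@?f z)) =>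
      apply: (recursive_pred_comp H (f := f))
  | H : recursive ?f |- recursive ?f => exact H
  | H : recursive_pred ?f |- recursive_pred ?f => exact H
  end.

(** * Recursively enumerable relations *)

Definition re T {cT : coding T} (A : T -> Prop) :=
  exists2 D : T * nat -> bool, recursive_pred D &
    forall x, A x <-> exists w, D (x, w).

Lemma re_ext T {cT : coding T} (A B : T -> Prop) :
  (forall x, A x <-> B x) -> re A -> re B.
Proof. by move=> AB [D rD DP]; exists D => // x; rewrite -AB. Qed.

Lemma re_comp T U {cT : coding T} {cU : coding U} (A : U -> Prop) (f : T -> U) :
  re A -> recursive f -> re (fun x => A (f x)).
Proof.
move=> [D rD DP] rf; exists (fun z => D (f z.1, z.2)) => //.
apply: (recursive_pred_comp (f := fun z : T * nat => (f z.1, z.2)) rD); recursion.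
Qed.

Lemma re_bool T {cT : coding T} (A : T -> bool) :
  recursive_pred A -> re (fun x => A x).
Proof.
move=> rA; exists (fun z => A z.1); first by recursion.
by move=> x; split=> [|[]] //; exists 0.
Qed.

Lemma re_eq T {cT : coding T} (U : eqType) {cU : coding U} (f g : T -> U) :
  recursive f -> recursive g -> re (fun x => f x = g x).
Proof.
move=> rf rg; apply: (re_ext (A := fun x => f x == g x)).
  by move=> x; split=> /eqP.
by apply: re_bool; recursion.
Qed.

Lemma re_and T {cT : coding T} (A B : T -> Prop) :
  re A -> re B -> re (fun x => A x /\ B x).
Proof.
move=> [D rD DP] [E rE EP].
exists (fun z => D (z.1, nfst z.2) && E (z.1, nsnd z.2)) => [|x].
  by recursion.
rewrite DP EP; split=> [[[v Dv] [w Ew]]|[w /andP[Dw Ew]]].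
  by exists (npair v w); rewrite nfst_pair nsnd_pair Dv.
by split; [exists (nfst w)|exists (nsnd w)].
Qed.

Lemma re_or T {cT : coding T} (A B : T -> Prop) :
  re A -> re B -> re (fun x => A x \/ B x).
Proof.
move=> [D rD DP] [E rE EP]; exists (fun z => D (z.1, z.2) || E (z.1, z.2)) => [|x].
  by recursion.
rewrite DP EP; split=> [[[w Dw]|[w Ew]]|[w /orP[Dw|Ew]]].
- by exists w; rewrite Dw.
- by exists w; rewrite Ew orbT.
- by left; exists w.
- by right; exists w.
Qed.

Lemma re_exists T U {cT : coding T} {cU : coding U} (A : T -> U -> Prop) :
  re (fun z : T * U => A z.1 z.2) -> re (fun x => exists y, A x y).
Proof.
move=> [D rD DP].
exists (fun z => D ((z.1, dec (nfst z.2)), nsnd z.2)) => [|x].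
  apply: (recursive_comp rD); recursion.
  by apply: (recursive_comp (@recursive_dec _ _)); recursion.
split=> [[y /(DP (x, y))[w Dw]]|[w Dw]].
  by exists (npair (enc y) w); rewrite nfst_pair nsnd_pair encK.
by exists (dec (nfst w)); apply/(DP (x, _)); exists (nsnd w).
Qed.

(** The witnesses for the finitely many entries have a common bound, and this bound is the single
    witness searched for. *)
Lemma re_all T (U : eqType) {cT : coding T} {cU : coding U} (A : T -> U -> Prop)
    (L : T -> seq U) :
  re (fun z : T * U => A z.1 z.2) -> recursive L ->
  re (fun x => forall y, y \in L x -> A x y).
Proof.
move=> [D rD DP] rL.
exists (fun z => all (fun y => has (fun w => D ((z.1, y), w)) (iota 0 z.2)) (L z.1)).
  apply: recursive_all; last by recursion.
  apply: (recursive_has (A := fun z0 w => D ((z0.1.1, z0.2), w))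
    (f := fun z0 : T * nat * U => iota 0 z0.1.2)); last by recursion.
  by apply: (recursive_comp rD); recursion.
move=> x; split=> [LA|[N /allP LN] y /LN /hasP[w _ Dw]]; last first.
  by apply/(DP (x, y)); exists w.
have {LA} : forall y, y \in L x -> exists w, D ((x, y), w).
  by move=> y /LA /(DP (x, y)).
elim: (L x) => [|y s IH] LA; first by exists 0.
have [w Dw] := LA y (mem_head _ _).
have [z zs|N /allP IHN] := IH; first by apply: LA; rewrite inE zs orbT.
exists (maxn w.+1 N); apply/allP => z; rewrite inE => /predU1P[->|/IHN /hasP[v]].
  by apply/hasP; exists w; rewrite // mem_iota leq_max leqnn.
rewrite mem_iota => vN Dv; apply/hasP; exists v; rewrite // mem_iota.
by rewrite leq_max /=; rewrite /= in vN; rewrite vN orbT.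
Qed.

Lemma re_ball T {cT : coding T} (A : T -> nat -> Prop) (b : T -> nat) :
  re (fun z : T * nat => A z.1 z.2) -> recursive b ->
  re (fun x => forall n, n < b x -> A x n).
Proof.
move=> rA rb; apply: (re_ext (A := fun x => forall n, n \in iota 0 (b x) -> A x n)).
  by move=> x; split=> H n; move: (H n); rewrite mem_iota.
by apply: re_all => //; recursion.
Qed.

Ltac re_tac := repeat lazymatch goal with
  | |- re (fun z => @?A z /\ @?B z) => apply: (@re_and _ _ A B)
  | |- re (fun z => @?A z \/ @?B z) => apply: (@re_or _ _ A B)
  | |- re (fun z => exists y, _) => apply: re_exists
  | |- re (fun z => forall y, is_true (y \in _) -> _) => apply: re_all
  | |- re (fun z => forall y, is_true (y < _) -> _) => apply: re_ball
  | |- re (fun z => @?f z = @?g z) => apply: (@re_eq _ _ _ _ f g)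
  | |- re (fun z => is_true (@?A z)) => apply: (@re_bool _ _ A)
  | H : re ?A |- re (fun z => ?A (@?f z)) => apply: (re_comp (f := f) H)
  | H : re ?A |- re ?A => exact H
  | |- recursive _ => progress recursion
  | |- recursive_pred _ => progress recursion
  end.

(** * Computations relative to finite strings *)

(** The oracle is given by a graph, which may be partial: a finite string can then serve as oracle,
    queries beyond its end diverging. *)
Fixpoint geval (G : nat -> nat -> Prop) (c : code) : nat -> nat -> Prop :=
  match c with
  | Zero => fun x y => y = 0
  | Succ => fun x y => y = x.+1
  | Fst => fun x y => y = nfst x
  | Snd => fun x y => y = nsnd x
  | Oracle => G
  | Pair c d => fun x y =>
      exists y1 y2, [/\ geval G c x y1, geval G d x y2 & y = npair y1 y2]
  | Comp c d => fun x y => exists2 z, geval G d x z & geval G c z y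
  | Prec c d => fun x y =>
      prec_graph (geval G c) (geval G d) (nfst x) (nsnd x) y
  | Mu c => fun x y =>
      geval G c (npair x y) 0 /\
      (forall z, z < y -> exists v, geval G c (npair x z) v.+1)
  end.

Lemma prec_graph_mono (F F' G G' : nat -> nat -> Prop) :
  (forall x y, F x y -> F' x y) -> (forall x y, G x y -> G' x y) ->
  forall x n y, prec_graph F G x n y -> prec_graph F' G' x n y.
Proof.
move=> FF GG x; elim=> [|n IH] y /=; first exact: FF.
by move=> [z /IH zP /GG]; exists z.
Qed.

(** The oracle occurs only positively; even [Mu] demands that the earlier values exist and are
    positive, not merely that none is 0. *)
Lemma geval_mono (G G' : nat -> nat -> Prop) :
  (forall x y, G x y -> G' x y) ->
  forall c x y, geval G c x y -> geval G' c x y.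
Proof.
move=> GG; elim=> //=.
- move=> c IHc d IHd x y [y1 [y2 [/IHc ? /IHd ? ->]]].
  by exists y1, y2.
- by move=> c IHc d IHd x y [z /IHd ? /IHc ?]; exists z.
- by move=> c IHc d IHd x y; apply: prec_graph_mono.
- move=> c IHc x y [/IHc ? H]; split=> // z /H [v /IHc ?].
  by exists v.
Qed.

Lemma eval_geval g c x y : eval g c x y <-> geval (fun x y => y = g x) c x y.
Proof.
suff -> : eval g c = geval (fun x y => y = g x) c by [].
by elim: c => //= [c -> d ->|c -> d ->|c -> d ->|c ->].
Qed.

(** Packs the intermediate values into one list, which turns recursion on [n] into an existential
    and a bounded universal quantifier, the form needed in [re_geval]. *)
Lemma prec_graphP (F G : nat -> nat -> Prop) x n y :
  prec_graph F G x n y <->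
  exists L : seq nat, [/\ size L = n.+1, F x (nth 0 L 0), nth 0 L n = y &
    forall m, m < n -> G (npair x (npair m (nth 0 L m))) (nth 0 L m.+1)].
Proof.
elim: n y => [|n IH] y /=.
  split=> [Fxy|[L [_ FL <- _]]] //.
  by exists [:: y].
split=> [[z /IH [L [sL FL Ln GL]] Gy]|[L [sL FL Ln GL]]].
  exists (rcons L y); rewrite size_rcons sL; split=> //.
  - by rewrite nth_rcons sL.
  - by rewrite nth_rcons sL ltnn eqxx.
  move=> m; rewrite ltnS leq_eqVlt => /predU1P[->|mn].
    by rewrite !nth_rcons sL ltnSn ltnn eqxx Ln.
  by rewrite !nth_rcons sL !ltnS (ltnW mn) mn; apply: GL.
exists (nth 0 L n); last by rewrite -Ln; apply: GL.
apply/IH; exists (take n.+1 L); rewrite size_take sL ltnSn; split=> //.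
- by rewrite nth_take.
- by rewrite nth_take.
by move=> m mn; rewrite !nth_take ?ltnS //; [apply/GL/ltnW|exact: ltnW].
Qed.

(** The parameter in [T] lets the oracle vary with the input; in [re_string_eval] it is the
    string. *)
Lemma re_geval T {cT : coding T} (G : T -> nat -> nat -> Prop) c :
  re (fun z : T * (nat * nat) => G z.1 z.2.1 z.2.2) ->
  re (fun z : T * (nat * nat) => geval (G z.1) c z.2.1 z.2.2).
Proof.
move=> rG; elim: c => /=; try by re_tac.
- move=> c IHc d IHd.
  apply: (re_ext (A := fun z : T * (nat * nat) => exists y1 y2,
    geval (G z.1) c z.2.1 y1 /\ geval (G z.1) d z.2.1 y2 /\ z.2.2 = npair y1 y2)).
    by move=> z; split=> [[y1 [y2 [? [? ?]]]]|[y1 [y2 [? ? ?]]]]; exists y1, y2.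
  re_tac.
    by apply: (re_comp (f := fun z : T * (nat * nat) * nat * nat =>
      (z.1.1.1, (z.1.1.2.1, z.1.2))) IHc); recursion.
  by apply: (re_comp (f := fun z : T * (nat * nat) * nat * nat =>
    (z.1.1.1, (z.1.1.2.1, z.2))) IHd); recursion.
- move=> c IHc d IHd.
  apply: (re_ext (A := fun z : T * (nat * nat) => exists y,
    geval (G z.1) d z.2.1 y /\ geval (G z.1) c y z.2.2)).
    by move=> z; split=> [[y [? ?]]|[y ? ?]]; exists y.
  re_tac.
    by apply: (re_comp (f := fun z : T * (nat * nat) * nat =>
      (z.1.1, (z.1.2.1, z.2))) IHd); recursion.
  by apply: (re_comp (f := fun z : T * (nat * nat) * nat =>
    (z.1.1, (z.2, z.1.2.2))) IHc); recursion.
- move=> c IHc d IHd.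
  apply: (re_ext (A := fun z : T * (nat * nat) => exists L : seq nat,
    size L = (nsnd z.2.1).+1 /\ geval (G z.1) c (nfst z.2.1) (nth 0 L 0) /\
    nth 0 L (nsnd z.2.1) = z.2.2 /\
    forall m, m < nsnd z.2.1 -> geval (G z.1) d
      (npair (nfst z.2.1) (npair m (nth 0 L m))) (nth 0 L m.+1))).
    move=> z; rewrite prec_graphP.
    by split=> [[L [? [? [? ?]]]]|[L [? ? ? ?]]]; exists L.
  re_tac.
    by apply: (re_comp (f := fun z : T * (nat * nat) * seq nat =>
      (z.1.1, (nfst z.1.2.1, nth 0 z.2 0))) IHc); recursion.
  by apply: (re_comp (f := fun z : T * (nat * nat) * seq nat * nat =>
    (z.1.1.1, (npair (nfst z.1.1.2.1) (npair z.2 (nth 0 z.1.2 z.2)),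
     nth 0 z.1.2 z.2.+1))) IHd); recursion.
- move=> c IHc; re_tac.
    by apply: (re_comp (f := fun z : T * (nat * nat) =>
      (z.1, (npair z.2.1 z.2.2, 0))) IHc); recursion.
  by apply: (re_comp (f := fun z : T * (nat * nat) * nat * nat =>
    (z.1.1.1, (npair z.1.1.2.1 z.1.2, z.2.+1))) IHc); recursion.
Qed.

Lemma computable_recursive f : computable f -> recursive f.
Proof. by move=> cf; exists f. Qed.

Lemma re_partial_computable psi :
  partial_computable psi -> re (fun z : nat * nat => psi z.1 z.2).
Proof.
move=> [c cP]; apply: (re_ext (A := fun z : nat * nat =>
  geval (fun _ y => y = 0) c z.1 z.2)).
  by move=> z; rewrite cP eval_geval.
have rG : re (fun z : nat * (nat * nat) => z.2.2 = 0) by re_tac.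
apply: (re_comp (f := fun z : nat * nat => (0, (z.1, z.2)))
  (re_geval (G := fun _ _ y => y = 0) c rG)); recursion.
Qed.

Lemma eval_fun g c x y z : eval g c x y -> eval g c x z -> y = z.
Proof.
elim: c x y z => /=; try by move=> x y z -> ->.
- move=> c IHc d IHd x y z [y1 [y2 [cy dy ->]]] [z1 [z2 [cz dz ->]]].
  by rewrite (IHc _ _ _ cy cz) (IHd _ _ _ dy dz).
- move=> c IHc d IHd x y z [u du cu] [v dv cv].
  by rewrite (IHd _ _ _ dv du) in cv; exact: IHc cu cv.
- move=> c IHc d IHd x; elim: (nsnd x) => [|n IH] y z /=; first exact: IHc.
  move=> [u pu du] [v pv dv].
  by rewrite (IH _ _ pv pu) in dv; exact: IHd du dv.
- move=> c IHc x y z [y0 yP] [z0 zP].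
  case: (ltngtP y z) => // [/zP|/yP] [v cv].
    by have := IHc _ _ _ y0 cv.
  by have := IHc _ _ _ z0 cv.
Qed.

Definition string_graph (t : seq nat) (x y : nat) := x < size t /\ y = nth 0 t x.

Definition string_eval (t : seq nat) := geval (string_graph t).

Lemma re_string_eval c :
  re (fun z : seq nat * (nat * nat) => string_eval z.1 c z.2.1 z.2.2).
Proof. by apply: re_geval; rewrite /string_graph; re_tac. Qed.

Lemma string_eval_prefix t r c x y :
  prefix t r -> string_eval t c x y -> string_eval r c x y.
Proof.
move=> /prefixP[u ->]; apply: geval_mono => {}x {}y [xt ->]; split.
  by rewrite size_cat ltn_addr.
by rewrite nth_cat xt.
Qed.

Lemma prefix_mkseq (f : nat -> nat) m n : m <= n -> prefix (mkseq f m)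
    (mkseq f n).
Proof.
move=> mn; apply/prefixP; exists [seq f i | i <- iota m (n - m)].
by rewrite -map_cat -iotaD subnKC.
Qed.

Lemma string_eval_mkseq f n c x y : string_eval (mkseq f n) c x y ->
    eval f c x y.
Proof.
move=> H; apply/eval_geval; apply: geval_mono H => {}x {}y [].
by rewrite size_mkseq => xn ->; rewrite nth_mkseq.
Qed.

(** Use principle: a converging computation asks for finitely many oracle values. Subcomputations
    are merged by taking the maximum of their lengths. *)
Lemma eval_string_eval f c x y :
  eval f c x y -> exists n, string_eval (mkseq f n) c x y.
Proof.
have mono m n d u v : m <= n -> string_eval (mkseq f m) d u v ->
    string_eval (mkseq f n) d u v.
  by move=> mn; apply: string_eval_prefix; exact: prefix_mkseq.
elim: c x y => /=; try by move=> x y ->; exists 0.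
- move=> x y ->; exists x.+1; split; first by rewrite size_mkseq.
  by rewrite nth_mkseq.
- move=> c IHc d IHd x y [y1 [y2 [/IHc[m cm] /IHd[n dn] ->]]].
  exists (maxn m n), y1, y2; split=> //.
    by apply: (mono m) => //; exact: leq_maxl.
  by apply: (mono n) => //; exact: leq_maxr.
- move=> c IHc d IHd x y [z /IHd[m dm] /IHc[n cn]].
  exists (maxn m n), z.
    by apply: (mono m) => //; exact: leq_maxl.
  by apply: (mono n) => //; exact: leq_maxr.
- move=> c IHc d IHd x; rewrite /string_eval /=.
  elim: (nsnd x) => [|k IH] y /=; first by move=> /IHc.
  move=> [z /IH[m dm] /IHd[n cn]].
  exists (maxn m n), z.
    by apply: prec_graph_mono dm => u v; apply: mono; exact: leq_maxl.
  by apply: (mono n) => //; exact: leq_maxr.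
- move=> c IHc x y [/IHc[m cm] H].
  suff [n nP] : exists n, forall z, z < y ->
      exists v, string_eval (mkseq f n) c (npair x z) v.+1.
    exists (maxn m n); split.
      by apply: (mono m) => //; exact: leq_maxl.
    move=> z /nP[v vP]; exists v.
    by apply: (mono n) => //; exact: leq_maxr.
  elim: y H {m cm} => [|y IH] H; first by exists 0.
  have [z zy|m mP] := IH; first by apply: H; exact: ltnW.
  have [v /IHc[n nP]] := H _ (ltnSn y).
  exists (maxn m n) => z; rewrite ltnS leq_eqVlt => /predU1P[->|/mP[w wP]].
    by exists v; apply: (mono n) => //; exact: leq_maxr.
  by exists w; apply: (mono m) => //; exact: leq_maxl.
Qed.

Lemma npair_enc T (cT : coding T) (x : T) n : npair (enc x) n = enc (x, n).
Proof. by []. Qed.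

(** * Unbounded search and effective dependent choice *)

Lemma re_domain T {cT : coding T} (A : T -> Prop) : re A ->
  exists2 psi, partial_computable psi & forall x, A x <-> exists y, psi (enc x) y.
Proof.
move=> [D rD DP].
(* [Mu] looks for zeros, so the program computes the negation. *)
have [d [c cP] dP] : recursive_pred (fun z => ~~ D z) by recursion.
exists (eval (fun=> 0) (Mu c)) => [|x]; first by exists (Mu c).
rewrite DP; split=> [/ex_minnP[w Dw wmin]|[w [/cP]]]; last first.
  by rewrite npair_enc -dP => /esym/eqP; rewrite eqb0 negbK; exists w.
exists w; split=> [|z zw].
  by apply/cP; rewrite npair_enc -dP Dw.
exists 0; apply/cP; rewrite npair_enc -dP.
by case Dz: (D _) => //; move: (wmin _ Dz); rewrite leqNgt zw.
Qed.

(** Each next term is found by unbounded search, so the whole sequence is recursive; the invariant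
    [I] guarantees that every search succeeds. *)
Lemma re_dependent_choice T {cT : coding T} (R : T -> T -> Prop)
    (I : T -> Prop) x0 :
  re (fun z : T * T => R z.1 z.2) -> I x0 ->
  (forall x, I x -> exists y, R x y) -> (forall x y, I x -> R x y -> I y) ->
  exists X : nat -> T,
    [/\ recursive X, X 0 = x0, forall n, I (X n) & forall n, R (X n) (X n.+1)].
Proof.
move=> [D rD DP] Ix0 ex_R RI.
(* The number searched for packs a successor and a witness for [R]. *)
pose E (z : T * nat) := ~~ D ((z.1, @dec T cT (nfst z.2)), nsnd z.2).
have [d [c cP] dP] : recursive_pred E.
  apply: recursive_negb; apply: (recursive_comp rD); recursion.
  by apply: (recursive_comp (@recursive_dec _ _)); recursion.
have eval_c x m y : eval (fun=> 0) c (npair (enc x) m) y <-> y = E (x, m).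
  by rewrite -cP npair_enc -dP.
have step x : exists y, I x ->
    R x y /\ forall n, eval (fun=> 0) (Comp Fst (Mu c)) (enc x) n <-> n = enc y.
  have [Ix|nIx] := pselect (I x); last by exists x.
  have [y /(DP (x, y))[v Dv]] := ex_R x Ix.
  have : exists m, ~~ E (x, m).
    by exists (npair (enc y) v); rewrite /E negbK /= nfst_pair nsnd_pair encK.
  move=> /ex_minnP[m Em mmin]; exists (dec (nfst m)) => _; split.
    by apply/(DP (x, _)); exists (nsnd m); rewrite /E negbK in Em.
  have mu_m : eval (fun=> 0) (Mu c) (enc x) m.
    split; first by apply/eval_c; rewrite (negbTE Em).
    move=> z zm; exists 0; apply/eval_c.
    by case Ez: (E _) => //; move: (mmin z); rewrite Ez leqNgt zm => /(_ isT).
  move=> n; split=> [[z mu_z ->]|->]; last by exists m => //=; rewrite decK.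
  by rewrite decK (eval_fun (mu_z : eval _ (Mu c) _ z) mu_m).
(* [F] is chosen classically, but on [I] its values are those of one fixed program. *)
have [F FP] := choice step.
pose X n := iter n F x0.
have IX n : I (X n).
  by elim: n => //= n IH; apply: (RI (X n)) => //; have [] := FP _ IH.
exists X; split=> // [|n]; last by have [] := FP _ (IX n).
have [c0 c0P] := computable_cst (enc x0).
have [ci ciP] := computable_id.
exists (fun n => enc (X n)) => //.
(* The parameter of the recursion is the constant 0; [Comp Snd Snd] extracts the previous value [r]
   from the argument [(0, (m, r))]. *)
exists (Comp (Prec c0 (Comp (Comp Fst (Mu c)) (Comp Snd Snd))) (Pair Zero ci)) => x y.
suff H : forall n y, y = @enc T cT (X n) <->
    prec_graph (eval (fun=> 0) c0)
      (eval (fun=> 0) (Comp (Comp Fst (Mu c)) (Comp Snd Snd))) 0 n y.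
  rewrite H; split=> [Hx|[z [y1 [y2 [-> /ciP -> ->]]]]]; last first.
    by rewrite /= nfst_pair nsnd_pair.
  exists (npair 0 x); last by rewrite /= nfst_pair nsnd_pair.
  by exists 0, x; split=> //; apply/ciP.
move=> {x y}; elim=> [|n IH] y /=; first exact: c0P.
have [_ Fn] := FP _ (IX n).
split=> [->|[z /IH -> [u [v -> ->]]]].
  exists (enc (X n)); first exact/IH.
  exists (enc (X n)); last by apply/Fn.
  eexists; first reflexivity.
  by rewrite /= !nsnd_pair.
by rewrite /= !nsnd_pair => /Fn.
Qed.

(** * Big sets of strings *)

Definition branching (n : nat) (T : seq nat -> Prop) (t : seq nat) :=
  exists l : seq nat,
    [/\ uniq l, 2 ^ n <= size l & forall x, x \in l -> T (rcons t x)].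

(** A derivation is a finite tree with leaves in [B] that splits [2 ^ p k]-fold at its inner nodes
    of length [k]. *)
Inductive big (p : nat -> nat) (T B : seq nat -> Prop) : seq nat -> Prop :=
  | big_in t : B t -> big p T B t
  | big_step t l : uniq l -> 2 ^ p (size t) <= size l ->
      (forall x, x \in l -> T (rcons t x)) ->
      (forall x, x \in l -> big p T B (rcons t x)) -> big p T B t.

Lemma branching_mono m n (T T' : seq nat -> Prop) t :
  m <= n -> (forall r, T r -> T' r) -> branching n T t -> branching m T' t.
Proof.
move=> mn TT' [l [ul sl Tl]]; exists l; split=> // [|x /Tl/TT' //].
by rewrite (leq_trans _ sl) // leq_pexp2l.
Qed.

Lemma big_mono p (T T' B B' : seq nat -> Prop) t :
  (forall r, T r -> T' r) -> (forall r, B r -> B' r) ->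
  big p T B t -> big p T' B' t.
Proof.
move=> TT' BB'; elim=> {t} [t Bt|t l ul sl Tl _ IH]; first exact/big_in/BB'.
by apply: big_step ul sl _ IH => x /Tl/TT'.
Qed.

(** Pigeonhole at every inner node: of [2 * 2 ^ p] children, [2 ^ p] are big for the same one of the
    two sets. *)
Lemma big_or p (T B C : seq nat -> Prop) t :
  big (fun n => (p n).+1) T (fun r => B r \/ C r) t -> big p T B t \/ big p T C t.
Proof.
elim=> {t} [t [Bt|Ct]|t l ul sl Tl _ IH].
- by left; exact: big_in.
- by right; exact: big_in.
pose a x := `[< big p T B (rcons t x) >].
have := count_predC a l; rewrite -!size_filter => sizes.
have [la|la] := leqP (2 ^ p (size t)) (size [seq x <- l | a x]).
  left; apply: big_step la _ _; first exact: filter_uniq.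
    by move=> x; rewrite mem_filter => /andP[_ /Tl].
  by move=> x; rewrite mem_filter => /andP[/asboolP].
right; apply: (@big_step _ _ _ _ [seq x <- l | predC a x]).
- exact: filter_uniq.
- move: sl; rewrite expnS mul2n -addnn -sizes => sl.
  by rewrite leqNgt; apply/negP => lc; move: sl; rewrite leqNgt -addSn leq_add // ltnW.
- by move=> x; rewrite mem_filter => /andP[_ /Tl].
- move=> x; rewrite mem_filter => /andP[/asboolP nb /IH[]//].
Qed.

Lemma small_child p (T B : seq nat -> Prop) t n :
  ~ big p T B t -> p (size t) <= n -> branching n T t ->
  exists x, T (rcons t x) /\ ~ big p T B (rcons t x).
Proof.
move=> nb pn [l [ul sl Tl]]; apply: contrapT => H; apply: nb.
apply: (big_step ul _ Tl) => [|x xl]; first by rewrite (leq_trans _ sl) // leq_pexp2l.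
by apply: contrapT => nb; apply: H; exists x; split=> //; exact: Tl.
Qed.

(** Turns a derivation of [big] into explicit finite lists, the nodes [N] and the frontier [F],
    which can be coded and searched for. *)
Lemma big_finite_tree p (T B : seq nat -> Prop) t : T t -> big p T B t ->
  exists N F : seq (seq nat), [/\ t \in N,
    forall r, r \in N -> [/\ T r, prefix t r &
      r \in F \/ branching (p (size r)) (fun u => u \in N) r] &
    forall r, r \in F -> r \in N /\ B r].
Proof.
move=> + bt; elim: bt => {t} [t Bt|t l ul sl Tl _ IH] Tt.
  exists [:: t], [:: t]; split; first by rewrite mem_head.
    move=> r; rewrite inE => /eqP ->; split=> //; first exact: prefix_refl.
    by left; rewrite ?eqxx ?mem_head.
  by move=> r; rewrite inE => /eqP ->; rewrite eqxx.
have {}IH x : exists NF : seq (seq nat) * seq (seq nat), x \in l ->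
    [/\ rcons t x \in NF.1,
      forall r, r \in NF.1 -> [/\ T r, prefix (rcons t x) r &
        r \in NF.2 \/ branching (p (size r)) (fun u => u \in NF.1) r] &
      forall r, r \in NF.2 -> r \in NF.1 /\ B r].
  have [xl|] := boolP (x \in l); last by exists ([::], [::]).
  by have [N [F NF]] := IH x xl (Tl x xl); exists (N, F).
have [f fP] := choice IH.
have mem_N x r : x \in l -> r \in (f x).1 -> r \in flatten [seq (f x).1 | x <- l].
  by move=> xl rx; apply/flatten_mapP; exists x.
exists (t :: flatten [seq (f x).1 | x <- l]), (flatten [seq (f x).2 | x <- l]).
split; first by rewrite mem_head.
  move=> r; rewrite inE => /predU1P[->|/flatten_mapP[x xl rx]].
    split=> //; first exact: prefix_refl.
    right; exists l; split=> // x xl; rewrite inE; apply/orP; right.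
    by apply: mem_N (xl) _; have [] := fP x xl.
  have [_ fN fF] := fP x xl; have [Tr tr rF] := fN r rx; split=> //.
    by apply: prefix_trans tr; exact: prefix_rcons.
  case: rF => [rF|br]; first by left; apply/flatten_mapP; exists x.
  right; apply: branching_mono br => // u ux.
  by rewrite inE (mem_N x) ?orbT.
move=> r /flatten_mapP[x xl rx].
have [_ _ fF] := fP x xl; have [rN Br] := fF r rx.
by rewrite inE (mem_N x) ?orbT.
Qed.

(* The pairs i < j form the shift graph, in which (i, j) is adjacent to (j, k);
   its chromatic number is infinite, so some pair has none of the finitely many
   colours c with ~ Q i j c. *)
Lemma shift_graph_pigeonhole (K : eqType) (F : seq K)
    (Q : nat -> nat -> K -> Prop) a :
  (forall i j k c, i < j -> j < k -> c \in F -> Q i j c \/ Q j k c) ->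
  exists i j, [/\ a < i, i < j & forall c, c \in F -> Q i j c].
Proof.
move=> QF; apply: contrapT => noij.
(* The number [a.+1 + x] is labelled by the set of [c] for which [Q] fails with some later [j].
   There are more numbers than labels; two with equal label form the required pair, since a failure
   there would give another failure from the second number on, against [QF]. *)
pose g (x : 'I_(2 ^ size F).+1) : (size F).-tuple bool :=
  [tuple of [seq `[< exists2 j, (a.+1 + x) < j & ~ Q (a.+1 + x) j c >] | c <- in_tuple F]].
suff g_inj : injective g.
  have := leq_card g g_inj; rewrite card_ord card_tuple card_bool.
  by rewrite ltnn.
suff lt_g (x y : 'I_(2 ^ size F).+1) : x < y -> g x <> g y.
  move=> x y gxy; apply/val_inj => /=.
  by case: (ltngtP x y) => // /lt_g; rewrite gxy.
move=> xy gxy; apply: noij; exists (a.+1 + x), (a.+1 + y); split.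
- by rewrite addSn ltnS leq_addr.
- by rewrite ltn_add2l.
move=> c cF; apply: contrapT => nQ.
have /eq_in_map/(_ c cF) /= :
    [seq `[< exists2 j, (a.+1 + x) < j & ~ Q (a.+1 + x) j c >] | c <- F] =
    [seq `[< exists2 j, (a.+1 + y) < j & ~ Q (a.+1 + y) j c >] | c <- F].
  exact: (congr1 (@tval _ _) gxy).
move=> Hxy; have [H _] := asbool_eq_equiv Hxy.
have [|k yk nQ'] := H; first by exists (a.+1 + y); rewrite // ltn_add2l.
by have [] := QF (a.+1 + x) (a.+1 + y) k c _ yk cF; rewrite ?ltn_add2l.
Qed.

(** * Convergence and the events to be forced *)

Definition converges c n (t : seq nat) := exists v, string_eval t c n v.

(** The event S i j as seen by the finite string [t]: a computed value already contradicts bit 1 at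
    [i] or bit 0 at [j]. In this positive form it is r.e. and passes to longer strings. *)
Definition avoids c i j (t : seq nat) :=
  (exists v, v <> 1 /\ string_eval t c i v) \/
  (exists v, v <> 0 /\ string_eval t c j v).

(** The shared index decides: a nonzero value at [j] settles the pair [(i, j)], the value 0 settles
    [(j, k)]. *)
Lemma converges_avoids c i j k t :
  converges c j t -> avoids c i j t \/ avoids c j k t.
Proof.
move=> [[|v] jv]; last by left; right; exists v.+1.
by right; left; exists 0.
Qed.

Lemma converges_prefix c n t r : prefix t r -> converges c n t ->
    converges c n r.
Proof. by move=> tr [v /(string_eval_prefix tr)]; exists v. Qed.

Lemma avoids_prefix c i j t r : prefix t r -> avoids c i j t -> avoids c i j r.
Proof.
by move=> tr [] [v [v1 /(string_eval_prefix tr) rv]]; [left|right]; exists v.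
Qed.

Lemma re_converges c n : re (converges c n).
Proof.
apply: re_exists.
by apply: (re_comp (f := fun z : seq nat * nat => (z.1, (n, z.2))) (re_string_eval c));
  recursion.
Qed.

Lemma re_avoids c :
  re (fun z : seq nat * (nat * nat) => avoids c z.2.1 z.2.2 z.1).
Proof.
have neq k : re (fun z : seq nat * (nat * nat) * nat => z.2 <> k).
  apply: (re_ext (A := fun z => z.2 != k)); last by re_tac.
  by move=> z; split=> /eqP.
rewrite /avoids; re_tac; try exact: neq.
  by apply: (re_comp (f := fun z : seq nat * (nat * nat) * nat =>
    (z.1.1, (z.1.2.1, z.2))) (re_string_eval c)); recursion.
by apply: (re_comp (f := fun z : seq nat * (nat * nat) * nat =>
  (z.1.1, (z.1.2.2, z.2))) (re_string_eval c)); recursion.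
Qed.

Lemma re_branching T {cT : coding T} (n : T -> nat) (N : T -> seq (seq nat))
    (t : T -> seq nat) :
  recursive n -> recursive N -> recursive t ->
  re (fun x => branching (n x) (fun u => u \in N x) (t x)).
Proof.
move=> rn rN rt; apply: (re_ext (A := fun x => exists l : seq nat,
    (uniq l /\ 2 ^ n x <= size l) /\ forall y, y \in l -> rcons (t x) y \in N x)).
  by move=> x; split=> [[l [[? ?] ?]]|[l [? ? ?]]]; exists l.
by re_tac.
Qed.

(** * Refinement of the tree in stages *)

Definition fat (T B : seq nat -> Prop) (q : nat -> nat) (s : seq nat) :=
  forall r, T r -> prefix s r -> B r \/ branching (q (size r)) T r.

(* A stage ((i, j), (N, F)) consists of two bits, the nodes N of a finite tree
   and its frontier F. *)
Definition stage := ((nat * nat) * (seq (seq nat) * seq (seq nat)))%type.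

(** The new pair lies beyond the old one, and the new tree grows from the old frontier, whose bad
    strings may stay leaves, until every leaf is bad or shows the new event. All clauses are r.e.,
    so a next stage can be found by search. *)
Definition next_stage (T B : seq nat -> Prop) (q : nat -> nat) c (x y : stage) :=
  [/\ x.1.2 < y.1.1 /\ y.1.1 < y.1.2,
      forall r, r \in x.2.2 ->
        B r \/ branching (q (size r)) (fun u => u \in y.2.1) r,
      forall r, r \in y.2.1 ->
        [/\ T r, exists u, u \in x.2.2 /\ prefix u r &
            r \in y.2.2 \/ branching (q (size r)) (fun u => u \in y.2.1) r] &
      forall r, r \in y.2.2 -> r \in y.2.1 /\ (B r \/ avoids c y.1.1 y.1.2 r)].

Lemma re_next_stage T B q c : re T -> re B -> recursive q ->
  re (fun z : stage * stage => next_stage T B q c z.1 z.2).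
Proof.
move=> rT rB rq; apply: (re_ext (A := fun z : stage * stage =>
    ((z.1.1.2 < z.2.1.1 /\ z.2.1.1 < z.2.1.2) /\
    (forall r, r \in z.1.2.2 ->
        B r \/ branching (q (size r)) (fun u => u \in z.2.2.1) r)) /\
    ((forall r, r \in z.2.2.1 ->
        (T r /\ exists u, u \in z.1.2.2 /\ prefix u r) /\
            (r \in z.2.2.2 \/ branching (q (size r)) (fun u => u \in z.2.2.1) r)) /\
    (forall r, r \in z.2.2.2 ->
        r \in z.2.2.1 /\ (B r \/ avoids c z.2.1.1 z.2.1.2 r))))).
  move=> z; split.
    move=> [[[? ?] ?] [H ?]]; split=> // r /H[[? ?] ?]; split=> //.
  by move=> [[? ?] ? H ?]; split=> //; split=> // r /H[? ? ?].
re_tac; try by apply: re_branching; recursion.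
apply: (re_comp (f := fun z : stage * stage * seq nat =>
  (z.2, (z.1.2.1.1, z.1.2.1.2))) (re_avoids c)); recursion.
Qed.

(** Each good frontier string is first split once, so that the tree keeps growing even where the
    event already holds. The shift graph then gives one pair that works above all the children, and
    the finite trees obtained are glued. [big_or] costs the extra 1 in the exponent. *)
Lemma next_stage_exists T B q c s (x : stage) :
  fat T B q s ->
  (forall t n, T t -> prefix s t ->
     big (fun k => (q k).+1) T (fun r => B r \/ converges c n r) t) ->
  (forall r, r \in x.2.2 -> T r /\ prefix s r) ->
  exists y, next_stage T B q c x y.
Proof.
case: x => [[i0 j0] [N0 F0]] /= fatT bigT F0T.
have : forall r, exists l : seq nat, r \in F0 ->
    [/\ uniq l, forall x, x \in l -> T (rcons r x) & B r \/ 2 ^ q (size r) <= size l].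
  move=> r; have [rF|] := boolP (r \in F0); last by exists [::].
  have [Tr sr] := F0T r rF.
  have [Br|[l [ul sl Tl]]] := fatT r Tr sr; last by exists l => _; split=> //; right.
  by exists [::] => _; split=> //; left.
move=> /choice[l lP].
pose F1 := [seq rcons r x | r <- F0, x <- l r].
have F1P t : t \in F1 -> [/\ T t, prefix s t & exists u, u \in F0 /\ prefix u t].
  move=> /allpairsPdep[r [x [rF xl ->]]].
  have [_ Tl _] := lP r rF; have [_ sr] := F0T r rF; split.
  - exact: Tl.
  - by apply: prefix_trans sr _; exact: prefix_rcons.
  - by exists r; split=> //; exact: prefix_rcons.
(* The strings of [F1] are the colours; the pair is sought beyond [j0]. *)
have [|i [j [ji ij F1big]]] := @shift_graph_pigeonhole _ F1
    (fun i j => big q T (fun r => B r \/ avoids c i j r)) j0.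
  move=> i j k t ij jk tF; have [Tt st _] := F1P t tF.
  apply: big_or; apply: big_mono (bigT t j Tt st) => // r.
  move=> [Br|/(@converges_avoids _ i j k)[]]; by [left; left|left; right|right; right].
have : forall t, exists NF : seq (seq nat) * seq (seq nat), t \in F1 ->
    [/\ t \in NF.1,
      forall r, r \in NF.1 -> [/\ T r, prefix t r &
        r \in NF.2 \/ branching (q (size r)) (fun u => u \in NF.1) r] &
      forall r, r \in NF.2 -> r \in NF.1 /\ (B r \/ avoids c i j r)].
  move=> t; have [tF|] := boolP (t \in F1); last by exists ([::], [::]).
  have [Tt _ _] := F1P t tF.
  by have [N [F NF]] := big_finite_tree Tt (F1big t tF); exists (N, F).
move=> /choice[f fP].
have mem_N t r : t \in F1 -> r \in (f t).1 -> r \in flatten [seq (f t).1 | t <- F1].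
  by move=> tF rt; apply/flatten_mapP; exists t.
exists ((i, j), (flatten [seq (f t).1 | t <- F1], flatten [seq (f t).2 | t <- F1])).
split=> //=.
- move=> r rF; have [ul Tl [Br|sl]] := lP r rF; first by left.
  right; exists (l r); split=> // x xl.
  have rxF : rcons r x \in F1 by apply/allpairsPdep; exists r, x.
  by apply: mem_N (rxF) _; have [] := fP _ rxF.
- move=> r /flatten_mapP[t tF rt].
  have [_ fN fF] := fP t tF; have [Tr tr rF] := fN r rt; split=> //.
    have [_ _ [u [uF ut]]] := F1P t tF; exists u; split=> //.
    exact: prefix_trans ut tr.
  case: rF => [rF|br]; first by left; apply/flatten_mapP; exists t.
  by right; apply: branching_mono br => // u; exact: mem_N.
- move=> r /flatten_mapP[t tF rt].
  have [_ _ fF] := fP t tF; have [rN Br] := fF r rt.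
  by split=> //; exact: mem_N rN.
Qed.

(** [T'] consists of the nodes of a recursive sequence of stages and is therefore r.e. *)
Lemma tree_refinement T B q c s : re T -> re B -> recursive q -> T s ->
  fat T B q s ->
  (forall t r, B t -> prefix t r -> B r) ->
  (forall t n, T t -> prefix s t ->
     big (fun k => (q k).+1) T (fun r => B r \/ converges c n r) t) ->
  exists (T' : seq nat -> Prop) (ij : nat -> nat * nat),
    [/\ re T', forall t, T' t -> T t, T' s & fat T' B q s] /\
    [/\ recursive ij,
        forall n, (ij n).1 < (ij n).2 /\ (ij n).2 < (ij n.+1).1 &
        forall n, exists l, forall t, T' t -> l <= size t ->
          B t \/ avoids c (ij n).1 (ij n).2 t].
Proof.
move=> rT rB rq Ts fatT Bup bigT.
(* Stage 0 is the single string [s]; its pair [(0, 0)] is only a lower bound, and [ij] starts with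
   the pair of stage 1. *)
have [|||X [rX X0 IX RX]] :=
  @re_dependent_choice stage _ (next_stage T B q c)
    (fun x => forall r, r \in x.2.2 -> T r /\ prefix s r)
    ((0, 0), ([:: s], [:: s])) (re_next_stage c rT rB rq).
- by move=> r; rewrite inE => /eqP ->; split=> //; exact: prefix_refl.
- by move=> x Ix; exact: next_stage_exists fatT bigT Ix.
- move=> x y Ix [_ _ yN yF] r /yF[/yN[Tr [u [uF ur]] _] _]; split=> //.
  by have [_ su] := Ix u uF; exact: prefix_trans su ur.
have FN n r : r \in (X n).2.2 -> r \in (X n).2.1.
  case: n => [|n]; first by rewrite X0.
  by have [_ _ _ yF] := RX n; move=> /yF[].
have NF n r : r \in (X n).2.1 -> r \in (X n).2.2 \/
    branching (q (size r)) (fun u => u \in (X n).2.1) r.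
  case: n => [|n]; first by rewrite X0; left.
  by have [_ _ yN _] := RX n; move=> /yN[].
exists (fun r => exists n, r \in (X n).2.1), (fun n => (X n.+1).1); split; split.
- by re_tac.
- move=> t [[|n]]; first by rewrite X0 inE => /eqP ->.
  by have [_ _ yN _] := RX n; move=> /yN[].
- by exists 0; rewrite X0 mem_head.
- move=> r [n /NF[rF|br]] _; last first.
    by right; apply: branching_mono br => // u uN; exists n.
  have [_ xF _ _] := RX n; have [Br|br] := xF r rF; first by left.
  by right; apply: branching_mono br => // u uN; exists n.+1.
- by recursion.
- move=> n; have [[_ ij] _ _ _] := RX n.
  by have [[ji _] _ _ _] := RX n.+1.
move=> n.
have above k r : r \in (X (k + n.+1)).2.2 ->
    exists u, u \in (X n.+1).2.2 /\ prefix u r.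
  elim: k r => [|k IH] r; first by exists r; rewrite prefix_refl.
  rewrite addSn; have [_ _ yN yF] := RX (k + n.+1).
  move=> /yF[/yN[_ [u [uF ur]] _] _]; have [v [vF vu]] := IH u uF.
  by exists v; split=> //; exact: prefix_trans vu ur.
(* A node of [T'] of length at least [l] belongs to a stage after [n.+1], so it extends a frontier
   string of stage [n.+1], which is bad or shows the event of [ij n]. *)
have [l lP] : exists l, forall m t, m <= n.+1 -> t \in (X m).2.1 -> size t < l.
  elim: n.+1 => [|k [l lP]].
    by exists (size s).+1 => m t; rewrite leqn0 => /eqP ->; rewrite X0 inE => /eqP ->.
  exists (maxn l (\max_(t <- (X k.+1).2.1) (size t)).+1) => m t.
  rewrite leq_eqVlt => /predU1P[->|mk] tN; last by rewrite leq_max (lP m).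
  by rewrite leq_max ltnS; apply/orP; right; exact: leq_bigmax_seq.
exists l => t [m tm] lt.
have nm : n.+1 < m by rewrite ltnNge; apply/negP => /lP/(_ tm); rewrite ltnNge lt.
case: m nm tm => // m; rewrite ltnS => nm tm.
have [_ _ yN _] := RX m; have [_ [u [uF ut]] _] := yN t tm.
move: uF; rewrite -(subnK nm) => /above[v [vF vu]].
have vt := prefix_trans vu ut.
have [_ _ _ yF] := RX n; have [_ [Bv|av]] := yF v vF.
  by left; exact: Bup vt.
by right; exact: avoids_prefix av.
Qed.

(** * Null classes *)

Definition avoiding_class (ij : nat -> nat * nat) : set real :=
  fun Y => forall n, ~ (Y (ij n).1 /\ ~~ Y (ij n).2).

Lemma string_code_rcons s b : string_code (rcons s b) = (string_code s).*2 + b.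
Proof. by rewrite /string_code -cats1 foldl_cat. Qed.

Lemma string_code_gt0 s : 0 < string_code s.
Proof.
elim/last_ind: s => // s b IH.
by rewrite string_code_rcons addn_gt0 double_gt0 IH.
Qed.

Lemma string_code_inj : injective string_code.
Proof.
have neq1 s b : string_code (rcons s b) <> 1.
  rewrite string_code_rcons; have := string_code_gt0 s.
  by case: (string_code s) => // n _; rewrite doubleS.
elim/last_ind => [|s b IH]; elim/last_ind => [|t d _] //.
- by move=> /esym /neq1.
- by move=> /neq1.
rewrite !string_code_rcons ![_.*2 + _]addnC => e.
have := congr1 half e; rewrite !half_bit_double => /IH ->.
by have := congr1 odd e; rewrite !oddD !odd_double !addbF !oddb => ->.
Qed.

Lemma foldl_string_code s :
  foldl (fun k b => k.*2 + b) 1 [seq nat_of_bool b | b <- s] = string_code s.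
Proof. by rewrite /string_code; elim: s 1 => //= b s IH k; rewrite IH. Qed.

(** The complement is the union of the cylinders of an r.e. set of strings, those that exhibit bits
    1 and 0 at some pair. *)
Lemma Pi01_avoiding_class ij : recursive ij -> Pi01 (avoiding_class ij).
Proof.
move=> rij.
pose W s := exists n, [/\ (ij n).1 < size s, (ij n).2 < size s,
  nth false s (ij n).1 & ~~ nth false s (ij n).2].
exists W; split; last first.
  apply/seteqP; split=> [Y /existsNP[n /contrapT[Yi Yj]]|Y [s [n [i_s j_s si sj]] sY]].
    set m := (maxn (ij n).1 (ij n).2).+1.
    have im : (ij n).1 < m by rewrite ltnS leq_maxl.
    have jm : (ij n).2 < m by rewrite ltnS leq_maxr.
    exists (mkseq Y m); last first.
      by rewrite -[cylinder _ _]/(mkseq Y (size (mkseq Y m)) = mkseq Y m) size_mkseq.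
    by exists n; rewrite size_mkseq !nth_mkseq.
  move=> /(_ n); apply.
  by move: si sj; rewrite -sY !nth_mkseq.
(* Bit strings become lists of numbers at most 1, since the finite type [bool] is in no bijection
   with [nat]. *)
pose A m := exists (L : seq nat) (n : nat),
  (foldl (fun k b => k.*2 + b) 1 L = m /\ all (fun b => b <= 1) L) /\
  ((ij n).1 < size L /\ (ij n).2 < size L) /\
  (nth 0 L (ij n).1 = 1 /\ nth 0 L (ij n).2 = 0).
have rA : re A.
  rewrite /A; re_tac.
    by apply: recursive_foldl; recursion.
  by apply: recursive_all; recursion.
have [psi cpsi psiP] := re_domain rA.
have {}psiP m : A m <-> exists y, psi m y by exact: psiP.
exists psi; split=> // s; rewrite -psiP; split.
  move=> [n [i_s j_s si sj]]; exists (map nat_of_bool s), n; rewrite size_map.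
  split; [split|split=> //].
  - exact: foldl_string_code.
  - by rewrite all_map; apply/allP => -[].
  by rewrite !(nth_map false) // si (negbTE sj).
move=> [L [n [[Ls L1] [[i_s j_s] [Li Lj]]]]].
have LE : L = map nat_of_bool (map (fun b => b == 1) L).
  rewrite -map_comp -[LHS]map_id; apply/eq_in_map => b /(allP L1) /=.
  by case: b => [|[]].
have {Ls} sE : s = map (fun b => b == 1) L.
  apply: string_code_inj; by rewrite -Ls {1}LE foldl_string_code.
by exists n; rewrite sE size_map !(nth_map 0) // Li Lj.
Qed.

(** The pairs occupy disjoint positions, so the events are independent and each keeps three quarters
    of the strings. The proportion [(3 / 4) ^ k] is stated without fractions. *)
Lemma avoiding_class_cover ij :
  (forall n, (ij n).1 < (ij n).2 /\ (ij n).2 < (ij n.+1).1) ->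
  forall k, exists (C : seq (seq bool)) l,
    [/\ l <= (ij k).1, forall s, s \in C -> size s = l,
        size C * 4 ^ k = 3 ^ k * 2 ^ l &
        forall Y, avoiding_class ij Y -> mkseq Y l \in C].
Proof.
move=> ijP; elim=> [|k [C [l [lk Cl sC CY]]]].
  exists [:: [::]], 0; split=> // s.
  by rewrite inE => /eqP ->.
have [lt_ij jS] := ijP k.
set i := (ij k).1 in lk lt_ij *; set j := (ij k).2 in lt_ij jS *.
pose strings d : seq (seq bool) := [seq val t | t <- enum {: d.-tuple bool}].
have size_strings d : size (strings d) = 2 ^ d.
  by rewrite size_map -cardE card_tuple card_bool.
have mem_strings (s : seq bool) : s \in strings (size s).
  by apply/mapP; exists (in_tuple s); rewrite // mem_enum.
have stringsP d s : s \in strings d -> size s = d.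
  by move=> /mapP[t _ ->]; rewrite size_tuple.
(* The admissible bits at [i] and [j]: all but 1 followed by 0. In [f], the free blocks [su.2] and
   [vp.1] fill the positions before [i] and between [i] and [j]. *)
pose ends := [:: (false, false); (false, true); (true, true)].
pose f (su : seq bool * seq bool) (vp : seq bool * (bool * bool)) :=
  su.1 ++ su.2 ++ vp.2.1 :: rcons vp.1 vp.2.2.
exists [seq f su vp | su <- [seq (s, u) | s <- C, u <- strings (i - l)],
                      vp <- [seq (v, p) | v <- strings (j - i.+1), p <- ends]].
exists j.+1; split=> //.
- move=> s /allpairsPdep[su [vp []]].
  move=> /allpairsPdep[s' [u [s'C uP ->]]] /allpairsPdep[v [p [vP _ ->]]] ->.
  rewrite /f /= !size_cat /= size_rcons.
  rewrite (Cl _ s'C) (stringsP _ _ uP) (stringsP _ _ vP).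
  by move: lk lt_ij; clear; lia.
- rewrite !size_allpairs !size_strings /=.
  have -> : j.+1 = l + ((i - l) + ((j - i.+1) + 2)).
    by move: lk lt_ij; clear; lia.
  rewrite !expnD !expnS.
  move: sC; set a := 2 ^ (i - l); set b := 2 ^ (j - i.+1).
  set c := 4 ^ k; set d := 3 ^ k; set e := 2 ^ l => sC.
  transitivity (size C * c * (a * b * 12)); first by ring.
  by rewrite sC; ring.
move=> Y PY.
have YE : mkseq Y j.+1 = f (mkseq Y l, [seq Y x | x <- iota l (i - l)])
    ([seq Y x | x <- iota i.+1 (j - i.+1)], (Y i, Y j)).
  rewrite /f /= -map_rcons -map_cons -!map_cat; congr map.
  have -> : j.+1 = l + ((i - l) + (1 + ((j - i.+1) + 1))).
    by move: lk lt_ij; clear; lia.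
  rewrite !iotaD /= add0n subnKC // addn1 subnKC //.
  by rewrite cats1.
rewrite YE; apply: allpairs_f; apply: allpairs_f.
- exact: CY.
- by rewrite -[X in strings X](size_iota l) -(size_map Y).
- by rewrite -[X in strings X](size_iota i.+1) -(size_map Y).
have := PY k; rewrite -/i -/j /ends.
by case: (Y i); case: (Y j) => // /(_ (conj isT isT)).
Qed.

Section Measure.
Variable R : realType.
Import Order.TTheory GRing.Theory Num.Theory numFieldNormedType.Exports.
Local Open Scope classical_set_scope.
Local Open Scope ring_scope.

Lemma cantor_measure_ge0 (A : set real) : (0 <= cantor_measure R A)%E.
Proof.
apply: le_ereal_inf_tmp => _ [s _ <-]; apply: nneseries_ge0 => n _ _.
by rewrite lee_fin exprn_ge0.
Qed.

(* A finite cover is completed to an infinite one by cylinders of total measure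
   at most 2 ^ - k. *)
Lemma cantor_measure_finite_cover (A : set real) (C : seq (seq bool)) l k :
  (forall s, s \in C -> size s = l) -> (forall Y, A Y -> mkseq Y l \in C) ->
  (cantor_measure R A <= ((size C)%:R * 2^-1 ^+ l + 2^-1 ^+ k)%:E)%E.
Proof.
move=> Cl AC.
pose s i := if (i < size C)%N then nth [::] C i else nseq (k + i.+1) false.
apply: ge_ereal_inf; exists (\sum_(0 <= i <oo) ((2%:R^-1 : R) ^+ size (s i))%:E)%E.
  exists s => // Y AY; have YC := AC Y AY.
  exists (index (mkseq Y l) C) => //; rewrite /s index_mem YC nth_index //.
  by rewrite -[cylinder _ _]/(mkseq Y (size (mkseq Y l)) = mkseq Y l) size_mkseq.
apply: lime_le.
  by apply: is_cvg_nneseries => n _ _; rewrite lee_fin exprn_ge0.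
apply: nearW => n; rewrite sumEFin lee_fin.
have half_ge0 m : 0 <= (2^-1 : R) ^+ m by rewrite exprn_ge0.
(* Counting a filler for every index, also those below [size C], gives a closed form provable by
   induction. *)
suff : \sum_(0 <= i < n) (2%:R^-1 : R) ^+ size (s i) <=
    (minn n (size C))%:R * 2^-1 ^+ l + 2^-1 ^+ k * (1 - 2^-1 ^+ n).
  move=> /le_trans; apply; apply: lerD.
    by rewrite ler_wpM2r // ler_nat geq_minr.
  by rewrite ler_piMr // gerBl.
elim: n => [|n IH]; first by rewrite big_geq // min0n mul0r expr0 subrr mulr0 addr0.
rewrite big_nat_recr //=.
have : (2%:R^-1 : R) ^+ size (s n) <=
    (n < size C)%N%:R * 2^-1 ^+ l + 2^-1 ^+ k * 2^-1 ^+ n.+1.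
  rewrite /s; case: ifP => nC.
    by rewrite Cl ?mem_nth // mul1r lerDl mulr_ge0.
  by rewrite mul0r add0r size_nseq exprD.
have -> : minn n.+1 (size C) = (minn n (size C) + (n < size C))%N.
  by lia.
rewrite natrD mulrDl [in X in _ <= X -> _]exprS => H.
apply: le_trans (lerD IH H) _; rewrite le_eqVlt; apply/orP; left; apply/eqP.
by rewrite exprS; field.
Qed.

(** The covers of [avoiding_class_cover] bound the measure by [(3 / 4) ^ k + (1 / 2) ^ k] for every
    [k]. *)
Lemma cantor_measure_avoiding_class ij :
  (forall n, ((ij n).1 < (ij n).2)%N /\ ((ij n).2 < (ij n.+1).1)%N) ->
  cantor_measure R (avoiding_class ij) = 0%E.
Proof.
move=> ijP; apply/eqP; rewrite eq_le cantor_measure_ge0 andbT.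
apply/lee_addgt0Pr => e e0; rewrite add0e.
have cvg_sum : (fun k => (3 / 4) ^+ k + 2^-1 ^+ k : R) @ \oo --> (0 : R).
  rewrite -[X in _ --> X]addr0; apply: cvgD; apply: cvg_expr.
    by rewrite ger0_norm; lra.
  by rewrite ger0_norm; lra.
have /cvgrPdist_le /(_ e e0) [k _ /(_ k (leqnn k))] := cvg_sum.
rewrite sub0r normrN => /(le_trans (ler_norm _)) ke.
have [C [l [_ Cl sC AC]]] := avoiding_class_cover ijP k.
apply: le_trans (cantor_measure_finite_cover k Cl AC) _.
rewrite lee_fin (le_trans _ ke) // lerD2r exprMn !exprVn.
have sCR : (size C)%:R * 4 ^+ k = 3 ^+ k * 2 ^+ l :> R.
  by rewrite -!natrX -!natrM sC.
rewrite -[(size C)%:R](mulfK (_ : 4 ^+ k != 0)) ?expf_neq0 // sCR.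
by rewrite mulrAC mulfK // expf_neq0.
Qed.
End Measure.

(** * Forcing *)

(** Embedding programs into the countable type of generic trees yields an enumeration of all
    programs. *)
Fixpoint code_tree (c : code) : GenTree.tree nat :=
  match c with
  | Zero => GenTree.Leaf 0
  | Succ => GenTree.Leaf 1
  | Fst => GenTree.Leaf 2
  | Snd => GenTree.Leaf 3
  | Oracle => GenTree.Leaf 4
  | Pair c d => GenTree.Node 0 [:: code_tree c; code_tree d]
  | Comp c d => GenTree.Node 1 [:: code_tree c; code_tree d]
  | Prec c d => GenTree.Node 2 [:: code_tree c; code_tree d]
  | Mu c => GenTree.Node 3 [:: code_tree c]
  end.

Fixpoint tree_code (t : GenTree.tree nat) : code :=
  match t with
  | GenTree.Leaf 1 => Succ
  | GenTree.Leaf 2 => Fst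
  | GenTree.Leaf 3 => Snd
  | GenTree.Leaf 4 => Oracle
  | GenTree.Node 0 [:: t; u] => Pair (tree_code t) (tree_code u)
  | GenTree.Node 1 [:: t; u] => Comp (tree_code t) (tree_code u)
  | GenTree.Node 2 [:: t; u] => Prec (tree_code t) (tree_code u)
  | GenTree.Node 3 [:: t] => Mu (tree_code t)
  | _ => Zero
  end.

Lemma code_treeK : cancel code_tree tree_code.
Proof. by elim=> //= [c -> d ->|c -> d ->|c -> d ->|c ->]. Qed.

Definition nth_code n : code := if unpickle n is Some t then tree_code t else Zero.

Lemma nth_code_surj c : exists n, nth_code n = c.
Proof. by exists (pickle (code_tree c)); rewrite /nth_code pickleK code_treeK. Qed.

(** * Conditions and their extensions *)

(** [lo] and [hi] are the exponents p and q of the overview, as functions of the length. *)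
Record condition := Condition {
  stem : seq nat; tree : seq nat -> Prop; bad : seq nat -> Prop;
  lo : nat -> nat; hi : nat -> nat }.

Record valid (C : condition) : Prop := Valid {
  re_tree : re (tree C);
  re_bad : re (bad C);
  recursive_lo : recursive (lo C);
  recursive_hi : recursive (hi C);
  tree_stem : tree C (stem C);
  stem_small : ~ big (lo C) (tree C) (bad C) (stem C);
  tree_fat : fat (tree C) (bad C) (hi C) (stem C);
  bad_prefix : forall t r, bad C t -> prefix t r -> bad C r;
  lo_le_hi : forall n, size (stem C) <= n -> lo C n <= hi C n;
  hi_sub_lo : forall k, exists m, forall n, m <= n -> lo C n + k <= hi C n }.

Definition extends (C' C : condition) :=
  [/\ prefix (stem C) (stem C'), size (stem C) < size (stem C'),
      forall t, tree C' t -> tree C t & forall t, bad C t -> bad C' t].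

(** Only unboundedly many initial segments have to lie in [tree], which may fail to be closed under
    prefixes. *)
Definition passes (C : condition) (f : nat -> nat) :=
  (forall n, exists2 m, n <= m & tree C (mkseq f m)) /\
  (forall n, ~ bad C (mkseq f n)).

(** A small string is not bad, hence it branches, and [lo <= hi] makes some child small again. *)
Lemma small_extension C n : valid C ->
  exists s, [/\ prefix (stem C) s, size s = size (stem C) + n, tree C s &
    ~ big (lo C) (tree C) (bad C) s].
Proof.
move=> vC; elim: n => [|n [s [Cs sz Ts nb]]].
  exists (stem C); split; [exact: prefix_refl|by rewrite addn0| |].
    exact: tree_stem.
  exact: stem_small.
have [Bs|br] := tree_fat vC Ts Cs; first by case: nb; exact: big_in.
have [|x [Tx nbx]] := small_child nb _ br.
  by apply: lo_le_hi => //; rewrite sz leq_addr.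
exists (rcons s x); split=> //; last by rewrite size_rcons sz addnS.
by apply: prefix_trans Cs _; exact: prefix_rcons.
Qed.

Lemma diagonalize (R : realType) C c : valid C ->
  exists C', [/\ valid C', extends C' C &
    forall f Y, passes C' f -> (forall x y, y = nat_of_bool (Y x) <-> eval f c x y) ->
      ~ kurtz_random R Y].
Proof.
(* Where the gap between [lo] and [hi] is at least 4, [q.+1] is the exponent p' of the overview, and
   [lo <= q] and [q.+1 <= hi]. *)
move=> vC; pose q n := ((lo C n + hi C n)./2).-1.
have [m mP] := hi_sub_lo vC 4.
have rq : recursive q.
  have rlo := recursive_lo vC; have rhi := recursive_hi vC.
  by rewrite /q; recursion.
have lo_q n : m <= n -> lo C n <= q n.
  by move=> /mP; rewrite /q; lia.
have q_hi n : m <= n -> (q n).+1 <= hi C n.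
  by move=> /mP; rewrite /q; lia.
(* Moving up [m.+1] levels makes the stem strictly longer and reaches the region where the gap is at
   least 4. *)
have [s [Cs sz Ts nbs]] := small_extension m.+1 vC.
have ms t n : prefix s t -> size t <= n -> m <= n.
  by move=> /size_prefix; rewrite sz; lia.
have lt_stem t : prefix s t -> size (stem C) < size t.
  by move=> /size_prefix; rewrite sz; lia.
have Cst t : prefix s t -> prefix (stem C) t by exact: prefix_trans.
have fatC t : prefix s t -> fat (tree C) (bad C) (hi C) t.
  move=> st r Tr tr; apply: tree_fat => //; apply: prefix_trans Cs _.
  exact: prefix_trans tr.
(* Either divergence at some [n] can be forced by declaring convergence bad, or convergence at every
   argument is big above every string of the tree extending [s]. *)
have [[t [n [Tt st nb]]]|bigC] := pselect (exists t n, [/\ tree C t, prefix s t &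
    ~ big (fun k => (q k).+1) (tree C) (fun r => bad C r \/ converges c n r) t]).
  exists (Condition t (tree C) (fun r => bad C r \/ converges c n r)
    (fun k => (q k).+1) (hi C)); split.
  - split=> //=.
    + exact: re_tree.
    + by apply: re_or; [exact: re_bad|exact: re_converges].
    + by recursion.
    + exact: recursive_hi.
    + by move=> r Tr tr; have [] := fatC t st r Tr tr; [left; left|right].
    + move=> r u [Br|cr] ru; first by left; exact: bad_prefix ru.
      by right; exact: converges_prefix ru cr.
    + by move=> k tk; apply: q_hi; exact: ms tk.
    + move=> k; have [m' m'P] := hi_sub_lo vC (k.*2 + 4).
      by exists m' => j /m'P; rewrite /q; lia.
  - by split=> //=; [exact: Cst|exact: lt_stem|left].
  (* [Y] is total, so some initial segment of [f] makes [c] converge at [n] and is bad. *)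
  - move=> f Y [_ avoid] fY; exfalso.
    have [k kP] := eval_string_eval ((fY n _).1 erefl).
    by apply: (avoid k); right; exists (Y n).
have {}bigC t n : tree C t -> prefix s t ->
    big (fun k => (q k).+1) (tree C) (fun r => bad C r \/ converges c n r) t.
  by move=> Tt st; apply: contrapT => nb; apply: bigC; exists t, n.
have fats : fat (tree C) (bad C) q s.
  move=> r Tr sr; have [Br|br] := fatC s (prefix_refl s) r Tr sr; first by left.
  right; apply: branching_mono br => //; apply/ltnW/q_hi.
  exact: ms (leqnn _).
have [T' [ij [[rT' T'T T's fatT'] [rij ijP ijav]]]] :=
  tree_refinement (re_tree vC) (re_bad vC) rq Ts fats (bad_prefix vC) bigC.
(* Only [hi] drops, to [q]; smallness of the bad set survives in the subtree [T']. *)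
exists (Condition s T' (bad C) (lo C) q); split.
- split=> //=.
  + exact: re_bad.
  + exact: recursive_lo.
  + by move=> nb; apply: nbs; apply: big_mono nb.
  + exact: bad_prefix.
  + by move=> k sk; apply: lo_q; exact: ms (prefix_refl s) sk.
  + move=> k; have [m' m'P] := hi_sub_lo vC (k.*2 + 2).
    by exists m' => j /m'P; rewrite /q; lia.
- by split=> //=; apply: lt_stem; exact: prefix_refl.
move=> f Y [fT' avoid] fY kY.
(* Long initial segments of [f] in [T'] are not bad, so they show the event for every pair, which
   puts [Y] into the null class. *)
apply: (kY _ (Pi01_avoiding_class rij) (cantor_measure_avoiding_class R ijP)) => n.
have [l lP] := ijav n; have [k lk T'k] := fT' l.
have [|/avoid//|[[v [v1 iv]]|[v [v0 jv]]]] := lP _ T'k; first by rewrite size_mkseq.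
  move=> [Yi _]; apply: v1.
  by have /fY -> := string_eval_mkseq iv; rewrite Yi.
move=> [_ Yj]; apply: v0.
by have /fY -> := string_eval_mkseq jv; rewrite (negbTE Yj).
Qed.

(** Iterates [diagonalize] over all programs; [f] is the union of the stems. *)
Lemma generic_function (R : realType) C0 : valid C0 ->
  exists f, passes C0 f /\ forall Y, computes f Y -> ~ kurtz_random R Y.
Proof.
move=> vC0.
have : forall Cn : condition * nat, exists C', valid Cn.1 -> [/\ valid C', extends C' Cn.1 &
    forall f Y, passes C' f ->
      (forall x y, y = nat_of_bool (Y x) <-> eval f (nth_code Cn.2) x y) ->
      ~ kurtz_random R Y].
  move=> [C n]; have [vC|nvC] := pselect (valid C); last by exists C.
  by have [C' C'P] := diagonalize R (nth_code n) vC; exists C'.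
move=> /choice[F FP].
pose D n := iteri n (fun k C => F (C, k)) C0.
have vD n : valid (D n).
  by elim: n => //= n IH; have [] := FP (D n, n) IH.
have eD n : extends (D n.+1) (D n) by have [] := FP (D n, n) (vD n).
have sizeD n : n <= size (stem (D n)).
  by elim: n => // n IH; have [_ lt_size _ _] := eD n; exact: leq_ltn_trans lt_size.
have monoD m n : m <= n -> [/\ prefix (stem (D m)) (stem (D n)),
    forall t, tree (D n) t -> tree (D m) t & forall t, bad (D m) t -> bad (D n) t].
  move=> mn; rewrite -(subnK mn); elim: (n - m) => [|k [IH1 IH2 IH3]].
    by split=> //; exact: prefix_refl.
  have [pk _ tk bk] := eD (k + m); split.
  - exact: prefix_trans IH1 pk.
  - by move=> t /tk/IH2.
  - by move=> t /IH3/bk.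
(* The stem of [D n.+1] is longer than [n], so the default 0 is never returned. *)
pose f n := nth 0 (stem (D n.+1)) n.
have fD n : mkseq f (size (stem (D n))) = stem (D n).
  apply: (@eq_from_nth _ 0) => [|i]; rewrite size_mkseq // => i_n.
  rewrite nth_mkseq // /f.
  have [/prefixP[u uE] _ _] := monoD i.+1 (maxn i.+1 n) (leq_maxl _ _).
  have [/prefixP[v vE] _ _] := monoD n (maxn i.+1 n) (leq_maxr _ _).
  have := congr1 (nth 0 ^~ i) uE; rewrite vE !nth_cat i_n.
  by rewrite (leq_trans _ (sizeD i.+1)).
have passD n : passes (D n) f.
  split=> [m|m Bm].
    exists (size (stem (D (maxn m n)))).
      by apply: leq_trans (sizeD _); exact: leq_maxl.
    rewrite fD; have [_ tD _] := monoD n (maxn m n) (leq_maxr _ _).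
    by apply: tD; exact: tree_stem.
  (* A bad initial segment of [f] would make a later stem bad, hence big. *)
  apply: (stem_small (vD (maxn m n))); apply: big_in.
  have [_ _ bD] := monoD n (maxn m n) (leq_maxr _ _).
  apply: bD; apply: bad_prefix Bm _ => //; rewrite -fD; apply: prefix_mkseq.
  by apply: leq_trans (sizeD _); exact: leq_maxl.
exists f; split; first exact: (passD 0).
move=> Y [c cP]; have [n nE] := nth_code_surj c.
have [_ _ H] := FP (D n, n) (vD n).
by apply: H (passD n.+1) _ => /= x y; rewrite nE; exact: cP.
Qed.

(** * The initial condition *)

Lemma recursive_trunc_log2 T {cT : coding T} (f : T -> nat) :
  recursive f -> recursive (fun x => trunc_log 2 (f x)).
Proof.
(* The logarithm grows by 1 exactly when the argument reaches the next power of 2. *)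
move=> rf; apply: (recursive_ext (f := fun x =>
  iteri (f x) (fun m r => if 2 ^ r.+1 <= m.+1 then r.+1 else r) 0)).
  move=> x; elim: (f x) => [|m /= ->]; first by rewrite trunc_log0.
  have [->|m0] := posnP m; first by rewrite trunc_log0 trunc_log1.
  have /andP[lem ltm] := trunc_log_bounds (isT : 1 < 2) m0.
  apply/esym; case: leqP => le; apply: trunc_log_eq => //.
    by rewrite le /= expnS mul2n -addnn; lia.
  by rewrite (leq_trans lem).
by apply: recursive_iteri; recursion.
Qed.

Definition non_dnc (phi : nat -> nat -> nat -> Prop) (t : seq nat) :=
  exists e, e < size t /\ phi e e (nth 0 t e).

Definition bounded_string (h : nat -> nat) (t : seq nat) :=
  forall i, i < size t -> nth 0 t i < h i.

Lemma non_dnc_prefix phi t r : non_dnc phi t -> prefix t r -> non_dnc phi r.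
Proof.
move=> [e [et ephi]] /prefixP[u ->]; exists e.
by rewrite size_cat ltn_addr // nth_cat et.
Qed.

(** Two distinct new entries cannot both equal the unique value of [phi] at [size t]; as [2 ^ 1]
    children are needed, [t] is already non-DNC. *)
Lemma big_non_dnc phi T t :
  (forall e y z, phi e e y -> phi e e z -> y = z) ->
  big (fun=> 1) T (non_dnc phi) t -> non_dnc phi t.
Proof.
move=> phi_fun; elim=> // {}t l ul sl _ _ IH; apply: contrapT => nt.
have phil x : x \in l -> phi (size t) (size t) x.
  move=> /IH[e []]; rewrite size_rcons ltnS leq_eqVlt => /predU1P[->|et].
    by rewrite nth_rcons ltnn eqxx.
  by rewrite nth_rcons et => ephi; case: nt; exists e.
case: l ul sl phil {IH} => [|x [|y l]] //= /andP[xyl _] _ phil.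
have xy : x = y by apply: phi_fun; apply: phil; rewrite !inE eqxx ?orbT.
by rewrite xy mem_head in xyl.
Qed.

(** The given DNC function [g] supplies a good stem up to the length from which [h] is at least 2,
    so that twofold branching is available above it. *)
Lemma valid_initial phi h g : standard_enumeration phi -> order_function h ->
  DNC_bounded phi h g ->
  exists s, valid (Condition s (bounded_string h) (non_dnc phi) (fun=> 1)
    (fun n => trunc_log 2 (h n))).
Proof.
move=> [[c cP] _] [/computable_recursive rh h_mono h_unb] [gDNC gh].
have phi_fun e y z : phi e e y -> phi e e z -> y = z.
  have cE v : phi e e v <-> eval (fun=> 0) c (npair e e) v.
    by rewrite -cP nfst_pair nsnd_pair.
  by move=> /cE ey /cE; exact: eval_fun ey.
have log_unb k : exists m, forall n, m <= n -> k <= trunc_log 2 (h n).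
  have [m mh] := h_unb (2 ^ k); exists m => n /h_mono mn.
  by apply: trunc_log_max => //; exact/ltnW/(leq_trans mh).
have [m mlog] := log_unb 1.
exists (mkseq g m); split=> /=.
- by rewrite /bounded_string; re_tac.
- have rphi := re_partial_computable (ex_intro _ c cP).
  rewrite /non_dnc; re_tac.
  apply: (re_ext (A := fun z : seq nat * nat =>
    phi (nfst (npair z.2 z.2)) (nsnd (npair z.2 z.2)) (nth 0 z.1 z.2))).
    by move=> z; rewrite nfst_pair nsnd_pair.
  by apply: (re_comp (f := fun z : seq nat * nat => (npair z.2 z.2, nth 0 z.1 z.2)) rphi);
    recursion.
- exact: recursive_cst.
- exact: recursive_trunc_log2.
- by move=> i; rewrite size_mkseq => im; rewrite nth_mkseq.
- move=> /(big_non_dnc phi_fun)[e []]; rewrite size_mkseq => em.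
  by rewrite nth_mkseq // => /gDNC.
- move=> r Tr /size_prefix; rewrite size_mkseq => mr; right.
  exists (iota 0 (h (size r))); split; first exact: iota_uniq.
    rewrite size_iota; apply: trunc_logP => //.
    by case: (h _) (mlog _ mr) => //; rewrite trunc_log0.
  move=> x; rewrite mem_iota /= add0n => xh i.
  rewrite size_rcons ltnS leq_eqVlt nth_rcons => /predU1P[->|ir].
    by rewrite ltnn eqxx.
  by rewrite ir; exact: Tr.
- exact: non_dnc_prefix.
- by move=> n; rewrite size_mkseq => /mlog.
by move=> k; exact: log_unb.
Qed.

Theorem theorem4p2 (R : realType) (phi : nat -> nat -> nat -> Prop)
    (h : nat -> nat) :
  standard_enumeration phi ->
  order_function h ->
  (exists g : nat -> nat, DNC_bounded phi h g) ->
  exists f : nat -> nat,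
    DNC_bounded phi h f /\
    (forall Y : real, computes f Y -> ~ kurtz_random R Y).
Proof.
move=> phiP hP [g gP].
have [s vs] := valid_initial phiP hP gP.
have [f [[fT fB] fY]] := generic_function R vs.
exists f; split=> //; split=> [e y ey fe|e].
  (* A failure of DNC at [e] is visible in the initial segment of length [e.+1]. *)
  apply: (fB e.+1); exists e.
  by rewrite size_mkseq nth_mkseq // fe.
have [m em /(_ e)] := fT e.+1.
by rewrite size_mkseq nth_mkseq //; apply.
Qed.
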